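(* Let $\alpha=\beta>0$ (the critical case). For $\epsilon\in(0,1)$ let $\hat\tau(\epsilon n)$ be the first time the critical dynamic Erdős–Rényi graph on $n$ vertices, starting with no edges, has a (connected) component of size at least $\epsilon n$. Then $$\mathbb{E}[\hat\tau(\epsilon n)]\le e^{n\left(\epsilon^3/8+o_\epsilon(\epsilon^3)\right)+o_n(n)}.$$ That is, there is a function $r:(0,1)\to\mathbb{R}$ with $r(\epsilon)/\epsilon^3\to0$ as $\epsilon\to0$ and, for every $\epsilon\in(0,1)$, a sequence $h_\epsilon(n)$ with $h_\epsilon(n)/n\to0$ as $n\to\infty$, such that $\mathbb{E}[\hat\tau(\epsilon n)]\le e^{n(\epsilon^3/8+r(\epsilon))+h_\epsilon(n)}$ for all sufficiently large $n$.
   Context: Dynamic Erdős–Rényi graph: for $\alpha,\beta>0$ and an integer $n\ge2$, there are $n$ fixed vertices and, independently for each of the $\binom n2$ vertex pairs, if no edge is present an edge is added after an exponentially distributed time with rate $\frac{\beta}{n-1}$, and if an edge is present it is removed after an exponentially distributed time with rate $\alpha$. It is called critical when $\alpha=\beta$ (its stationary distribution is then the static Erdős–Rényi graph $G(n,1/n)$). The size of a component is its number of vertices. $o_n(n)$ denotes a quantity $f(n)$ with $f(n)/n\to0$ as $n\to\infty$. *)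

(* Defs.v *)
From mathcomp Require Import all_boot all_order all_algebra.
From mathcomp Require Import all_classical all_reals all_analysis.

Set Implicit Arguments.
Unset Strict Implicit.
Unset Printing Implicit Defensive.

Import Order.TTheory GRing.Theory Num.Theory.
Import numFieldNormedType.Exports.

Local Open Scope classical_set_scope.
Local Open Scope ring_scope.

Definition mutually_independent (R : realType) (d : measure_display)
    (Om : measurableType d) (P : probability Om R) (I : choiceType)
    (X : I -> {RV P >-> R}) : Prop :=
  forall (J : seq I) (A : I -> set R),
    uniq J -> (forall i, measurable (A i)) ->
    P (\bigcap_(i in [set` J]) (X i @^-1` A i)) =
    (\prod_(i <- J) P (X i @^-1` A i))%E.

Definition has_exponential_law (R : realType) (d : measure_display)
    (Om : measurableType d) (P : probability Om R) (rate : R)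
    (X : {RV P >-> R}) : Prop :=
  forall A : set R, measurable A ->
    distribution P X A = exponential_prob rate A.

Definition vpair (n : nat) : Type := {e : {set 'I_n} | #|e| == 2%N}.

(* hold e k is the length of the k-th (from k = 0) period during which the
   state of the pair e stays constant. The process starts with no edges, so e
   is absent during the even periods and present during the odd ones. *)
Record is_dynamic_ER (R : realType) (alpha beta : R) (n : nat)
    (d : measure_display) (Om : measurableType d) (P : probability Om R)
    (hold : vpair n -> nat -> {RV P >-> R}) : Prop := {
  hold_exponential : forall (e : vpair n) (k : nat),
    has_exponential_law (if odd k then alpha else beta / n.-1%:R) (hold e k);
  hold_independent :
    mutually_independent (fun ek : vpair n * nat => hold ek.1 ek.2) }.

Section Trajectory.
Context (R : realType) (n : nat) (Om : Type).
Variable hold : vpair n -> nat -> Om -> R.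

Definition jump_time (e : vpair n) (m : nat) (w : Om) : R :=
  \sum_(k < m) hold e k w.

(* The odd periods are [jump_time e 1, jump_time e 2[,
   [jump_time e 3, jump_time e 4[, and so on. *)
Definition present (w : Om) (t : R) (e : vpair n) : Prop :=
  exists k : nat, jump_time e k.*2.+1 w <= t < jump_time e k.*2.+2 w.

Definition adjacent (w : Om) (t : R) : rel 'I_n :=
  fun i j => `[< exists2 e : vpair n, val e = [set i; j]%SET & present w t e >].

Definition component (w : Om) (t : R) (v : 'I_n) : {set 'I_n} :=
  [set u | connect (adjacent w t) v u]%SET.

Definition has_component_ge (s : R) (w : Om) (t : R) : Prop :=
  exists v : 'I_n, s <= #|component w t v|%:R.

(* The value is +oo when there is no such time. *)
Definition hitting_time (s : R) (w : Om) : \bar R :=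
  ereal_inf [set t%:E | t in [set t : R | 0 <= t /\ has_component_ge s w t]].

End Trajectory.

(* Main.v *)
Require Import Defs.
From HB Require Import structures.
From mathcomp Require Import all_boot all_order all_algebra.
From mathcomp Require Import all_classical all_reals all_analysis.
From mathcomp Require Import ring lra zify.

(** The graph is inspected at the times [T, 2T, 3T, ...] with
    [T = ln n / alpha].  Whatever the past, every pair carries an edge at the
    next inspection with conditional probability at least
    [q = step_prob n = (1 - o(1)) / n]: an edge that is present survives for a
    time [T] with probability [1 / n], and an absent one appears exactly once
    and survives with a probability of the same order ([on_step]).  Since
    having a large component is an increasing property, each inspection
    succeeds with conditional probability at least [p], the probability that
    the static graph with edge probability [q] has a component with more than
    [eps * n] vertices ([le_wsum_mono], [history_step]).  Hence the first [k]
    inspections all fail with probability at most [(1 - p)^k], and the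
    expected hitting time is at most [T / p] ([expected_hitting_time_le]).

    It remains to bound [p] from below with the right exponential rate.  With
    [K = k + 1] about [eps * n], the component of a given vertex has exactly
    [K] vertices with probability
    [binomial(n - 1, k) * c_K * (1 - q)^(K (n - K))], where [c_K] is the
    probability that the random graph on [K] vertices is connected.  Exploring
    this graph from one vertex, one active vertex at a time, gives a recursion
    whose solution is bounded below by [(1 - (1 - q)^K)^k / K] ([attached_ge]);
    the induction closes thanks to the inequality of Bernoulli, and the bound
    is sharp up to a factor polynomial in [n].  Trees alone would not do: they
    give the constant [1/6] instead of [1/8].  With the bounds of Stirling,
    [ln (T / p) / n] is eventually at most a sequence that converges to
    [giant_rate eps] ([giant_prob_rate]), which is at most
    [eps^3 / 8 + eps^4 / 2] for small [eps] ([giant_rate_le]). *)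

Set Implicit Arguments.
Unset Strict Implicit.
Unset Printing Implicit Defensive.

Import Order.TTheory GRing.Theory Num.Theory.
Import numFieldNormedType.Exports.

Local Open Scope ring_scope.

(** * Sums of product weights over edge sets *)

(** The sum over the subsets [S] of [l] of [F S] times the weights [a e] for
    the [e] in [S] and [b e] for the others ([wsum_sum]).  The recursion over
    the list of edges reduces most properties to a one-line induction; with
    weights [q] and [1 - q] this is an expectation for the static random
    graph. *)
Fixpoint wsum (R : realFieldType) (E : finType) (a b : E -> R) (l : seq E)
    (F : {set E} -> R) : R :=
  if l is e :: l' then
    a e * wsum a b l' (fun S => F (e |: S)) + b e * wsum a b l' F
  else F finset.set0.

Local Notation bern q := (wsum (fun=> q) (fun=> 1 - q)).

Section ProductWeights.
Variables (R : realFieldType) (E : finType).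
Implicit Types (q x : R) (a b c : E -> R) (l : seq E) (F G : {set E} -> R) (S D : {set E}).

Lemma wsum_sum a b l F : uniq l ->
  wsum a b l F = \sum_(S : {set E} | S \subset [set x in l])
    (\prod_(e <- l) (if e \in S then a e else b e)) * F S.
Proof.
elim: l F => [|x l IHl] F /=.
  move=> _; rewrite (big_pred1 finset.set0) ?big_nil ?mul1r // => S /=.
  by rewrite (_ : [set y in [::]] = finset.set0) ?finset.subset0 //; apply/setP => y; rewrite !inE.
case/andP => xl ul; rewrite !IHl // [RHS](bigID (fun S : {set E} => x \in S)) /=; congr (_ + _).
- rewrite mulr_sumr [RHS](reindex_onto (fun S => x |: S) (fun S => S :\ x)) /=; last first.
    by move=> S /andP[_ xS]; rewrite finset.setD1K.
  apply: eq_big => [S|S SL].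
    rewrite !inE eqxx /= andbT; apply/idP/andP => [SL|[/fintype.subsetP SL /eqP <-]].
      split; first by apply/fintype.subsetP => y; rewrite !inE => /orP[->//|/(fintype.subsetP SL)]; rewrite inE => ->; rewrite orbT.
      rewrite finset.setU1K //; apply: contra xl => /(fintype.subsetP SL).
      by rewrite inE.
    apply/fintype.subsetP => y; rewrite !inE => /andP[yx /orP[/eqP yE|yS]].
      by rewrite yE eqxx in yx.
    have := SL y; rewrite !inE yS orbT => /(_ isT)/orP[/eqP yE|//].
    by rewrite yE eqxx in yx.
  rewrite big_cons !inE eqxx /= mulrA; congr (_ * _ * _).
  apply: eq_big_seq => y yl; rewrite !inE.
  by case: eqVneq => // yE; rewrite yE (negbTE xl) in yl.
rewrite mulr_sumr; apply: eq_big => [S|S SL].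
  apply/idP/andP => [SL|[/fintype.subsetP SL xS]].
    split; first by apply/fintype.subsetP => y /(fintype.subsetP SL); rewrite !inE => ->; rewrite orbT.
    by apply: contra xl => /(fintype.subsetP SL); rewrite inE.
  apply/fintype.subsetP => y yS; have := SL y yS; rewrite !inE => /orP[/eqP yE|//].
  by rewrite -yE yS in xS.
have xS : x \notin S by apply: contra xl => /(fintype.subsetP SL); rewrite inE.
by rewrite big_cons (negbTE xS) mulrA.
Qed.

Lemma wsum_ge0 a b l F : (forall e, 0 <= a e) -> (forall e, 0 <= b e) ->
  (forall S, 0 <= F S) -> 0 <= wsum a b l F.
Proof.
move=> a0 b0; elim: l F => [|e l IHl] F F0 //=.
by rewrite addr_ge0 // mulr_ge0 // IHl.
Qed.

Lemma wsum_mono a b l F G : (forall e, 0 <= a e) -> (forall e, 0 <= b e) ->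
  (forall S, F S <= G S) -> wsum a b l F <= wsum a b l G.
Proof.
move=> a0 b0; elim: l F G => [|e l IHl] F G FG //=.
by rewrite lerD // ler_wpM2l // IHl.
Qed.

Lemma wsum_add a b l F G :
  wsum a b l (fun S => F S + G S) = wsum a b l F + wsum a b l G.
Proof.
elim: l F G => [|e l IHl] F G //=.
by rewrite !IHl; ring.
Qed.

Lemma wsum0 a b l : wsum a b l (fun=> 0) = 0.
Proof. by elim: l => [//|e l /= ->]; rewrite !mulr0 addr0. Qed.

Lemma wsum_bigsum a b l (I : Type) (s : seq I) (Q : pred I) (F : I -> {set E} -> R) :
  wsum a b l (fun S => \sum_(i <- s | Q i) F i S) =
  \sum_(i <- s | Q i) wsum a b l (F i).
Proof.
elim: s => [|i s IHs].
  rewrite big_nil -[RHS](wsum0 a b l); congr wsum.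
  by apply/funext => S; rewrite big_nil.
rewrite big_cons -IHs; case: ifP => Qi; last first.
  by congr wsum; apply/funext => S; rewrite big_cons Qi.
by rewrite -wsum_add; congr wsum; apply/funext => S; rewrite big_cons Qi.
Qed.

(** One edge at a time: if [X >= Y] are the sums with and without the edge,
    then [a X + b Y = c Y + a (X - Y)] is increasing in [a].  This compares the
    dynamic graph, whose conditional edge probabilities [a e / c e] depend on
    the edge and on the past, with the static graph of parameter [q]. *)
Lemma le_wsum_mono a b c q l F :
  (forall e, 0 <= a e) -> (forall e, 0 <= b e) -> (forall e, a e + b e = c e) ->
  (forall e, q * c e <= a e) -> 0 <= q <= 1 ->
  (forall S S', S \subset S' -> F S <= F S') ->
  (forall S, 0 <= F S) ->
  \prod_(e <- l) c e * bern q l F <= wsum a b l F.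
Proof.
move=> a0 b0 abc qca /andP[q0 q1].
have c0 e : 0 <= c e by rewrite -abc addr_ge0.
elim: l F => [|e l IHl] F Fm F0; first by rewrite big_nil mul1r.
rewrite big_cons /=.
set X := wsum (fun=> q) _ l _; set Y := wsum (fun=> q) _ l _.
have XY : Y <= X.
  by apply: wsum_mono => [?|?|S] //; rewrite ?subr_ge0 // Fm // finset.subsetUr.
have X0 : \prod_(e <- l) c e * X <= wsum a b l (fun S => F (e |: S)).
  by apply: IHl => [S S' SS|S]; [apply: Fm; exact: finset.setUS|exact: F0].
have Y0 : \prod_(e <- l) c e * Y <= wsum a b l F by exact: IHl.
apply: le_trans (lerD (ler_wpM2l (a0 e) X0) (ler_wpM2l (b0 e) Y0)).
set p := \prod_(_ <- l) _; have p0 : 0 <= p by exact: prodr_ge0.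
have -> : b e = c e - a e by rewrite -abc; ring.
rewrite -subr_ge0.
have -> : a e * (p * X) + (c e - a e) * (p * Y) - c e * p * (q * X + (1 - q) * Y)
  = (a e - q * c e) * (p * (X - Y)) by ring.
by rewrite mulr_ge0 ?mulr_ge0 // subr_ge0.
Qed.

Definition depends_on D F := forall S, F S = F (S :&: D)%SET.

Lemma depends_onU1 D F e : depends_on D F -> depends_on D (fun S => F (e |: S)).
Proof.
move=> dF S; rewrite dF [in RHS]dF; congr F.
by apply/setP => y; rewrite !inE; case: (y == e); case: (y \in S); case: (y \in D).
Qed.

Lemma depends_onU1_notin D F e : depends_on D F -> e \notin D -> (fun S => F (e |: S)) = F.
Proof.
move=> dF eD; apply/funext => S; rewrite dF [in RHS]dF; congr F.
apply/setP => y; rewrite !inE; case: eqVneq => // ->.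
by rewrite (negbTE eD) !andbF.
Qed.

(** Revealing one edge changes at most one of the two factors, so the product
    formula passes through the recursion. *)
Lemma wsum_indep q l D D' F G : depends_on D F -> depends_on D' G -> [disjoint D & D'] ->
  bern q l (fun S => F S * G S) =
  bern q l F * bern q l G.
Proof.
elim: l F G => [//|e l IHl] F G dF dG DD /=.
rewrite (IHl F G) // (IHl (fun S => F (e |: S)) (fun S => G (e |: S))) //; last 2 first.
- exact: depends_onU1.
- exact: depends_onU1.
have [eD|eD] := boolP (e \in D).
  rewrite (depends_onU1_notin dG); first by ring.
  by rewrite (disjointFr DD eD).
by rewrite (depends_onU1_notin dF eD); ring.
Qed.

Lemma wsum_const q l x : bern q l (fun=> x) = x.
Proof. by elim: l => [//|e l /= ->]; ring. Qed.

Lemma wsum_edge q l e (t : bool) : uniq l -> e \in l ->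
  bern q l (fun S => ((e \in S) == t)%:R) =
  if t then q else 1 - q.
Proof.
elim: l => [//|f l IHl] /= /andP[fl ul]; rewrite in_cons.
case: (eqVneq e f) fl => [<- fl _|ef fl /= el].
  (* [X] collects the edges of the head of the list that were selected *)
  have H : forall X : {set E}, e \notin X ->
      bern q l (fun S => ((e \in X :|: S) == t)%:R : R) =
      bern q l (fun S => (false == t)%:R).
    elim: l fl {ul IHl} => [|g l IHl] /=.
      by move=> _ X eX; rewrite !inE (negbTE eX).
    rewrite in_cons negb_or => /andP[eg el] X eX.
    rewrite IHl //; congr (_ * _ + _).
    rewrite -(IHl el (g |: X)); last by rewrite !inE negb_or eg.
    congr wsum; apply/funext => S; congr ((_ \in _) == _)%:R.
    by rewrite finset.setUA [X :|: _]finset.setUC.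
  have h : bern q l (fun S => ((e \in S) == t)%:R : R) =
       bern q l (fun S => (false == t)%:R).
    rewrite -(H finset.set0) ?inE //.
    have -> : (fun S => ((e \in finset.set0 :|: S) == t)%:R) =
      (fun S => ((e \in S) == t)%:R : R).
      by apply/funext => S; rewrite finset.set0U.
    by [].
  rewrite h wsum_const.
  have -> : (fun S => ((e \in e |: S) == t)%:R : R) = (fun S => (true == t)%:R).
    by apply/funext => S; rewrite !inE eqxx.
  by rewrite wsum_const; case: (t); rewrite /=; ring.
have -> : (fun S => ((e \in f |: S) == t)%:R : R) = (fun S => ((e \in S) == t)%:R).
  by apply/funext => S; rewrite !inE (negbTE ef).
by rewrite IHl //; ring.
Qed.

Lemma depends_on_prod (es : seq E) (t : E -> bool) :
  depends_on [set x in es] (fun S => \prod_(e <- es) ((e \in S) == t e)%:R).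
Proof.
move=> S; apply: eq_big_seq => e ees.
by rewrite !inE ees andbT.
Qed.

Lemma wsum_edges q l (es : seq E) (t : E -> bool) : uniq l -> uniq es ->
  {subset es <= l} ->
  bern q l
    (fun S => \prod_(e <- es) ((e \in S) == t e)%:R) =
  \prod_(e <- es) (if t e then q else 1 - q).
Proof.
move=> ul; elim: es => [|e es IHes] /=.
  move=> _ _; rewrite big_nil -[RHS](wsum_const q l).
  by congr wsum; apply/funext => S; rewrite big_nil.
case/andP => ees ues sub; rewrite big_cons -IHes //; last first.
  by move=> y ys; apply: sub; rewrite in_cons ys orbT.
rewrite -(@wsum_edge q l e (t e)) //; last by rewrite sub ?mem_head.
rewrite -(@wsum_indep q l [set e] [set x in es]).
- by congr wsum; apply/funext => S; rewrite big_cons.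
- by move=> S; rewrite !inE eqxx andbT.
- exact: depends_on_prod.
by rewrite disjoints1 inE.
Qed.

End ProductWeights.

Lemma wsum_one (R : realFieldType) (E : finType) (a b : E -> R) l :
  wsum a b l (fun=> 1) = \prod_(e <- l) (a e + b e).
Proof.
elim: l => [|e l IHl] /=; first by rewrite big_nil.
by rewrite big_cons IHl mulrDl.
Qed.

Lemma wsum_map (R : realFieldType) (E E' : finType) (f : E -> E') (q : R) l
    (F : {set E'} -> R) :
  bern q l (fun S => F (f @: S)%SET) =
  bern q (map f l) F.
Proof.
elim: l F => [|e l IHl] F /=; first by rewrite imset0.
rewrite -!IHl; congr (_ * wsum _ _ _ _ + _).
by apply/funext => S; rewrite imsetU1.
Qed.

(** * Exploring a component *)

Lemma prod_indic (R : realFieldType) (T : Type) (s : seq T) (Q : pred T) :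
  \prod_(x <- s) ((Q x)%:R : R) = (all Q s)%:R.
Proof.
elim: s => [|x s IHs]; first by rewrite big_nil.
by rewrite big_cons IHs /=; case: (Q x); rewrite ?mul1r ?mul0r.
Qed.

Lemma sum_subsets (R : realFieldType) (T : finType) (B : {set T}) (f : nat -> R) :
  \sum_(J : {set T} | J \subset B) f #|J| =
  \sum_(j < #|B|.+1) f j *+ 'C(#|B|, j).
Proof.
rewrite (partition_big (fun J : {set T} => inord #|J| : 'I_(#|B|.+1)) predT) //=.
apply: eq_bigr => j _.
rewrite (eq_bigl (fun J : {set T} => J \in [set J : {set T} | J \subset B & #|J| == j])).
  rewrite (eq_bigr (fun=> f j)); last by move=> J; rewrite inE => /andP[_ /eqP ->].
  by rewrite sumr_const cards_draws.
move=> J; rewrite inE; case: (boolP (J \subset B)) => //= JB.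
by rewrite -val_eqE /= inordK // ltnS subset_leq_card.
Qed.

Lemma sum_binom_mul (R : realFieldType) (u w : R) b :
  \sum_(j < b.+1) (u ^+ j * w ^+ (b - j) * j%:R) *+ 'C(b, j) =
  b%:R * u * (u + w) ^+ b.-1.
Proof.
case: b => [|b]; first by rewrite big_ord_recl big_ord0 /= mulr0n !mulr0 mul0rn !mul0r addr0.
rewrite big_ord_recl /= mulr0 mul0rn add0r [u + w]addrC exprDn mulr_sumr.
apply: eq_bigr => j _; rewrite /bump /= add1n subSS exprS.
have h : (j.+1%:R * 'C(b.+1, j.+1)%:R = b.+1%:R * 'C(b, j)%:R :> R).
  by rewrite -!natrM -mul_bin_diag.
rewrite -(mulr_natr _ 'C(b.+1, _)) -(mulr_natr _ 'C(b, _)).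
rewrite -[LHS]mulrA h; ring.
Qed.

(** The induction step of [attached_ge] in closed form.  With
    [z = 1 - (1 - q)^(m+1)] the binomial sums evaluate to
    [(a z + b q) z^(b-1) / m], and after simplification the claim is
    [z <= (m + 1) q], the inequality of Bernoulli. *)
Lemma sum_peel_ge (R : realFieldType) (q : R) (a b m : nat) :
  0 <= q <= 1 -> (a + b = m)%N -> (0 < b)%N ->
  a.+1%:R / m.+1%:R * (1 - (1 - q) ^+ m.+1) ^+ b <=
  \sum_(j < b.+1) (q ^+ j * (1 - q) ^+ (b - j) *
    ((a + j)%:R / m%:R * (1 - (1 - q) ^+ m) ^+ (b - j))) *+ 'C(b, j).
Proof.
case/andP=> q0 q1 abm b0; have m0 : (0 < m)%N by lia.
set z' := 1 - (1 - q) ^+ m; set z := 1 - (1 - q) ^+ m.+1.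
have -> : \sum_(j < b.+1)
    (q ^+ j * (1 - q) ^+ (b - j) * ((a + j)%:R / m%:R * z' ^+ (b - j))) *+ 'C(b, j)
  = (a%:R * (q + (1 - q) * z') ^+ b + b%:R * q * (q + (1 - q) * z') ^+ b.-1) / m%:R.
  rewrite -sum_binom_mul [q + _]addrC exprDn mulr_sumr -big_split /= mulr_suml.
  apply: eq_bigr => j _; rewrite exprMn natrD.
  move: 'C(b, j) => c; rewrite -[LHS]mulr_natr.
  rewrite -[X in a%:R * X + _]mulr_natr -[X in (_ + X) * _]mulr_natr.
  move: (q ^+ j) ((1 - q) ^+ (b - j)) (z' ^+ (b - j)) (m%:R^-1) => u v w t.
  ring.
have -> : q + (1 - q) * z' = z by rewrite /z /z' exprS; ring.
have z0 : 0 <= z.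
  by rewrite subr_ge0 exprn_ile1 ?subr_ge0 // lerBlDr lerDl.
have zmq : z <= m.+1%:R * q.
  have bern k : 1 - k%:R * q <= (1 - q) ^+ k.
    elim: k => [|k IHk]; first by rewrite mul0r subr0 expr0.
    rewrite exprS; apply: le_trans (ler_wpM2l _ IHk); last by rewrite subr_ge0.
    rewrite -subr_ge0 -natr1.
    have -> : (1 - q) * (1 - k%:R * q) - (1 - (k%:R + 1) * q) = k%:R * q ^+ 2 by ring.
    by rewrite mulr_ge0 // sqr_ge0.
  by rewrite /z; have := bern m.+1; lra.
have -> : z ^+ b = z * z ^+ b.-1 by rewrite -exprS prednK.
set Z := z ^+ b.-1; have Z0 : 0 <= Z by exact: exprn_ge0.
have mR : m%:R = a%:R + b%:R :> R by rewrite -abm natrD.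
rewrite -subr_ge0.
have mp : 0 < m%:R :> R by rewrite ltr0n.
have m1p : 0 < m.+1%:R :> R by rewrite ltr0n.
have -> : (a%:R * (z * Z) + b%:R * q * Z) / m%:R - a.+1%:R / m.+1%:R * (z * Z)
   = b%:R * (m.+1%:R * q - z) * Z / (m%:R * m.+1%:R).
  rewrite -!natr1 mR; field.
  by rewrite -mR natr1 !lt0r_neq0.
by rewrite divr_ge0 ?mulr_ge0 ?subr_ge0.
Qed.

Section Exploration.
Variables (R : realFieldType) (V : finType).
Implicit Types (A B J : {set V}) (S : {set {set V}}).

Definition edge_rel S : rel V := fun i j => [set i; j]%SET \in S.

(** The edges that matter for attaching the vertices of [B] to those of [A]:
    edges inside [A] are left out, so that the rest of the exploration never
    looks again at the edges of a vertex already treated. *)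
Definition edges_towards A B : {set {set V}} :=
  [set e : {set V} | (e \subset A :|: B) && ~~ [disjoint e & B]].

Definition attached A B S : bool :=
  [forall b in B, [exists a in A,
    connect (edge_rel (S :&: edges_towards A B)) a b]].

Lemma attached_depends_on A B :
  depends_on (edges_towards A B) (fun S => (attached A B S)%:R : R).
Proof.
by move=> S; rewrite /attached -finset.setIA finset.setIid.
Qed.

Lemma attached_peel A B J x S : x \in A -> [disjoint A & B] -> J \subset B ->
  (forall b, b \in B -> ([set x; b] \in S) = (b \in J)) ->
  attached (A :\ x :|: J) (B :\: J) S -> attached A B S.
Proof.
move=> xA AB JB NJ /forallP att; apply/forallP => b; apply/implyP => bB.
have xJ y : y \in J -> connect (edge_rel (S :&: edges_towards A B)) x y.
  move=> yJ; apply: connect1; rewrite /edge_rel !inE NJ ?(fintype.subsetP JB) //.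
  have yB := fintype.subsetP JB _ yJ.
  rewrite yJ /=; apply/andP; split.
    by apply/fintype.subsetP => z; rewrite !inE => /orP[/eqP ->|/eqP ->]; rewrite ?xA ?yB ?orbT.
  by apply/negP => /disjoint_setI0/setP/(_ y); rewrite !inE eqxx orbT yB.
have [bJ|bJ] := boolP (b \in J).
  by apply/existsP; exists x; rewrite xA xJ.
have := att b; rewrite !inE bJ bB /= => /existsP[a /andP[aA ab]].
have sub : subrel (connect (edge_rel (S :&: edges_towards (A :\ x :|: J) (B :\: J))))
                  (connect (edge_rel (S :&: edges_towards A B))).
  apply: connect_sub => i j; rewrite /edge_rel !inE => /and3P[ijS sAB dB].
  apply: connect1; rewrite /edge_rel !inE ijS /=; apply/andP; split.
    apply/fintype.subsetP => z /(fintype.subsetP sAB); rewrite !inE.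
    case/orP => [/orP[/andP[_ ->//]|/(fintype.subsetP JB) ->]|/andP[_ ->]]; by rewrite orbT.
  apply: contra dB; apply: disjointWr.
  exact: finset.subsetDl.
move/sub in ab.
move: aA; rewrite !inE => /orP[/andP[_ aA]|aJ].
  by apply/existsP; exists a; rewrite aA.
by apply/existsP; exists x; rewrite xA /=; apply: connect_trans ab; exact: xJ.
Qed.

Variables (L : seq {set V}) (q : R).
Hypotheses (uL : uniq L) (fullL : forall x y : V, x != y -> [set x; y]%SET \in L).
Hypothesis q01 : 0 <= q <= 1.

Local Notation pr := (bern q L).

(** Reveal the neighbours [J] of [x] in [B].  They join [A], while [x] is
    dropped, and what remains depends on other edges only. *)
Lemma attached_rec A B x : x \in A -> [disjoint A & B] ->
  \sum_(J : {set V} | J \subset B)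
    q ^+ #|J| * (1 - q) ^+ (#|B| - #|J|) *
      pr (fun S => (attached (A :\ x :|: J) (B :\: J) S)%:R)
  <= pr (fun S => (attached A B S)%:R).
Proof.
move=> xA AB; case/andP: q01 => q0 q1.
have xB : x \notin B by rewrite (disjointFr AB xA).
pose es := [seq [set x; b] | b <- enum B].
have ues : uniq es.
  rewrite map_inj_in_uniq ?enum_uniq // => b c; rewrite !mem_enum => bB cB /setP/(_ b).
  rewrite !inE eqxx orbT => /esym/orP[/eqP bx|/eqP //].
  by rewrite -bx bB in xB.
have esL : {subset es <= L}.
  move=> e /mapP[b]; rewrite mem_enum => bB ->; apply: fullL.
  by apply: contraNneq xB => ->.
(* [x] is not in [J], so an edge [[set x; b]] meets [J] exactly when [b] does *)
pose t (J e : {set V}) := ~~ [disjoint e & J].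
have tE J b : J \subset B -> b \in B -> t J [set x; b] = (b \in J).
  move=> JB bB; rewrite /t; apply/idP/idP; last first.
    move=> bJ; apply/negP => /disjoint_setI0/setP/(_ b).
    by rewrite !inE eqxx orbT bJ.
  apply: contraR => bJ; rewrite finset.disjoints_subset.
  apply/fintype.subsetP => y; rewrite !inE => /orP[/eqP ->|/eqP -> //].
  by apply: contra xB; exact: (fintype.subsetP JB).
pose nb J S : R := \prod_(e <- es) ((e \in S) == t J e)%:R.
have nbE J : J \subset B -> pr (nb J) = q ^+ #|J| * (1 - q) ^+ (#|B| - #|J|).
  move=> JB; rewrite wsum_edges // big_map.
  rewrite (bigID (mem J)) /= !big_enum_cond /=; congr (_ * _).
    rewrite (eq_bigr (fun=> q)); last by move=> b /andP[bB bJ]; rewrite tE // bJ.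
    rewrite (eq_bigl (mem J)) ?prodr_const // => b /=.
    by apply/andP/idP => [[]//|bJ]; rewrite (fintype.subsetP JB).
  rewrite (eq_bigr (fun=> 1 - q)); last by move=> b /andP[bB bJ]; rewrite tE // (negbTE bJ).
  rewrite (eq_bigl (mem (B :\: J))) ?prodr_const ?finset.cardsDS // => b /=.
  by rewrite inE andbC.
have -> : \sum_(J : {set V} | J \subset B)
    q ^+ #|J| * (1 - q) ^+ (#|B| - #|J|) *
      pr (fun S => (attached (A :\ x :|: J) (B :\: J) S)%:R)
  = pr (fun S => \sum_(J : {set V} | J \subset B)
      nb J S * (attached (A :\ x :|: J) (B :\: J) S)%:R).
  rewrite wsum_bigsum; apply: eq_bigr => J JB; rewrite -nbE //.
  rewrite (@wsum_indep _ _ _ _ [set e in es] (edges_towards (A :\ x :|: J) (B :\: J))) //.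
  - exact: depends_on_prod.
  - exact: attached_depends_on.
  rewrite finset.disjoints_subset; apply/fintype.subsetP => e; rewrite !inE => /mapP[b].
  rewrite mem_enum => bB ->; rewrite negb_and; apply/orP; left.
  apply/negP => /fintype.subsetP/(_ x); rewrite !inE eqxx (negbTE xB) andbF orbF /= => /(_ isT).
  by move/(fintype.subsetP JB); rewrite (negbTE xB).
apply: wsum_mono => [_|_|S] //; first by rewrite subr_ge0.
(* at most one term of the sum is nonzero, the one of the actual neighbours *)
pose J0 := [set b in B | [set x; b]%SET \in S].
rewrite (bigD1 J0) /=; last by apply/fintype.subsetP => b; rewrite inE => /andP[].
have nb_bool J : J \subset B -> nb J S = (J == J0)%:R.
  move=> JB; rewrite /nb prod_indic; congr (_%:R); congr nat_of_bool.
  rewrite all_map; apply/allP/eqP => [h|-> b]; last first.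
    rewrite mem_enum => bB /=; rewrite tE ?inE ?bB //.
    by apply/fintype.subsetP => y; rewrite inE => /andP[].
  apply/setP => b; rewrite inE; have [bB|bB] /= := boolP (b \in B).
    by have := h b; rewrite mem_enum bB /= tE // => /(_ isT)/eqP.
  by apply: contraNF bB; exact: (fintype.subsetP JB).
rewrite big1 ?addr0; last by move=> J /andP[JB JJ]; rewrite nb_bool // (negbTE JJ) mul0r.
have J0B : J0 \subset B by apply/fintype.subsetP => y; rewrite inE => /andP[].
rewrite nb_bool // eqxx mul1r ler_nat.
case att: (attached _ _ S) => //.
rewrite (attached_peel xA AB J0B _ att) // => b bB.
by rewrite inE bB.
Qed.

(** For each vertex of [B], consider the time at which the exploration could
    discover it: these are independent geometric variables, all of them are
    within the [m = #|A| + #|B|] available steps with probability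
    [(1 - (1 - q)^m)^#|B|], and the factor [#|A| / m] bounds the conditional
    probability that the exploration never runs out of active vertices (as for
    parking functions).  The proof is by induction through [attached_rec]. *)
Lemma attached_ge A B : [disjoint A & B] ->
  #|A|%:R / (#|A| + #|B|)%:R * (1 - (1 - q) ^+ (#|A| + #|B|)) ^+ #|B|
  <= pr (fun S => (attached A B S)%:R).
Proof.
case/andP: (q01) => q0 q1.
have pr0 A' B' : 0 <= pr (fun S => (attached A' B' S)%:R).
  by apply: wsum_ge0 => // _; rewrite subr_ge0.
move: {-1}(#|A| + #|B|)%N (erefl (#|A| + #|B|)%N) => m mE.
rewrite -mE; elim: m A B mE => [|m IHm] A B mE AB; first by rewrite mE invr0 mulr0 mul0r.
have [A0|[x xA]] := set_0Vmem A.
  by rewrite A0 finset.cards0 !mul0r.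
have [B0|B0] := eqVneq B finset.set0.
  rewrite B0 finset.cards0 addn0 expr0 mulr1 divff; last first.
    by rewrite pnatr_eq0 -lt0n; apply/card_gt0P; exists x.
  have -> : (fun S => (attached A finset.set0 S)%:R : R) = (fun=> 1).
    apply/funext => S; suff -> : attached A finset.set0 S by [].
    by apply/forallP => b; rewrite inE.
  by rewrite wsum_const.
have b0 : (0 < #|B|)%N by rewrite card_gt0.
have a0 : (0 < #|A|)%N by apply/card_gt0P; exists x.
have m0 : (0 < m)%N by lia.
apply: le_trans (attached_rec xA AB).
set a := #|A| in mE a0 *; set b := #|B| in mE b0 *.
pose z' := 1 - (1 - q) ^+ m; pose z := 1 - (1 - q) ^+ m.+1.
have -> : (a + b)%N = m.+1 by [].
rewrite -/z.
have le1 : \sum_(J : {set V} | J \subset B)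
    q ^+ #|J| * (1 - q) ^+ (b - #|J|) * ((a.-1 + #|J|)%:R / m%:R * z' ^+ (b - #|J|))
  <= \sum_(J : {set V} | J \subset B)
    q ^+ #|J| * (1 - q) ^+ (#|B| - #|J|) *
      pr (fun S => (attached (A :\ x :|: J) (B :\: J) S)%:R).
  apply: ler_sum => J JB; apply: ler_wpM2l.
    by rewrite mulr_ge0 // exprn_ge0 // subr_ge0.
  have JA : [disjoint A :\ x & J].
    apply: disjointWr JB _; apply: disjointWl AB.
    by apply/fintype.subsetP => y; rewrite inE => /andP[].
  have cA : #|A :\ x :|: J| = (a.-1 + #|J|)%N.
    rewrite finset.cardsU (disjoint_setI0 JA) finset.cards0 subn0.
    by have := cardsD1 x A; rewrite xA /= => cx; rewrite /a cx.
  have cB : #|B :\: J| = (b - #|J|)%N by rewrite finset.cardsDS.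
  have jb : (#|J| <= b)%N by exact: subset_leq_card.
  have cm : (#|A :\ x :|: J| + #|B :\: J| = m)%N by rewrite cA cB; lia.
  have := IHm (A :\ x :|: J) (B :\: J) cm.
  rewrite cm cA cB; apply.
  rewrite finset.disjoints_subset; apply/fintype.subsetP => y; rewrite !inE.
  case/orP => [/andP[_ yA]|->//].
  by rewrite (disjointFr AB yA) andbF.
apply: le_trans le1.
have aa : a = a.-1.+1 by rewrite prednK.
rewrite (sum_subsets B (fun j => q ^+ j * (1 - q) ^+ (b - j) * ((a.-1 + j)%:R / m%:R * z' ^+ (b - j)))).
rewrite {1}aa; apply: sum_peel_ge; rewrite -/b //; lia.
Qed.

End Exploration.

(** * The law of a component size *)

Section ComponentSize.
Variables (R : realFieldType) (V : finType) (L : seq {set V}) (q : R).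
Hypotheses (uL : uniq L) (fullL : forall x y : V, x != y -> [set x; y]%SET \in L).
Hypothesis q01 : 0 <= q <= 1.

Local Notation pr := (bern q L).

Definition edge_component (S : {set {set V}}) v : {set V} :=
  [set u | connect (edge_rel S) v u]%SET.

Definition cut_edges (A : {set V}) : seq {set V} :=
  [seq [set x; y]%SET | x <- enum A, y <- enum (~: A)].

Lemma cut_edges_uniq A : uniq (cut_edges A).
Proof.
apply: allpairs_uniq; rewrite ?enum_uniq // => -[x y] [x' y'] /allpairsP[[a b]] /= [].
rewrite !mem_enum inE => aA bA [-> ->] /allpairsP[[a' b']] /= [].
rewrite !mem_enum inE => a'A b'A [-> ->] /setP E.
have := E a; have := E b; rewrite !inE !eqxx orbT /= => /esym/orP[/eqP ba|/eqP <-].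
  by rewrite ba a'A in bA.
move=> /esym/orP[/eqP <- //|/eqP ab].
by rewrite -ab aA in bA.
Qed.

Lemma size_cut_edges A : size (cut_edges A) = (#|A| * (#|V| - #|A|))%N.
Proof. by rewrite size_allpairs -!cardE [X in (_ * X)%N]cardsCs finset.setCK. Qed.

Lemma edge_component_eq v (J : {set V}) S : attached [set v] J S ->
  all (fun e => (e \in S) == false) (cut_edges (v |: J)) ->
  edge_component S v = v |: J.
Proof.
move=> /forallP att /allP cut; apply/eqP; rewrite finset.eqEsubset; apply/andP; split.
  have cl : closed_mem (edge_rel S) (mem (v |: J)).
    have step x y : edge_rel S x y -> x \in v |: J -> y \in v |: J.
      move=> xy xJ; apply: contraT => yJ.
      have := cut [set x; y]%SET; rewrite eqbF_neg; move: xy; rewrite /edge_rel => ->.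
      case/(_ _)/negP => //; apply/allpairsP; exists (x, y); split => //=; rewrite mem_enum //.
      by rewrite finset.in_setC.
    move=> x y xy /=; apply/idP/idP; apply: step => //.
    by rewrite /edge_rel finset.setUC.
  apply/fintype.subsetP => u; rewrite inE => /(closed_connect cl) <-.
  by rewrite !inE eqxx.
apply/fintype.subsetP => u; rewrite !inE => /orP[/eqP -> //|uJ].
have := att u; rewrite uJ => /existsP[a]; rewrite inE => /andP[/eqP ->].
apply: connect_sub => x y xy; apply: connect1; move: xy.
by rewrite /edge_rel inE => /andP[].
Qed.

(** The events that the component of [v] is exactly [v |: J] are disjoint
    for different [J]; each of them says that [J] is attached to [v] and that
    no edge leaves [v |: J], two independent conditions. *)
Lemma edge_component_size_ge v k : (k < #|V|)%N ->
  'C(#|V|.-1, k)%:R * (k.+1%:R^-1 * (1 - (1 - q) ^+ k.+1) ^+ k)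
    * (1 - q) ^+ (k.+1 * (#|V| - k.+1))
  <= pr (fun S => (k < #|edge_component S v|)%:R).
Proof.
move=> kV; case/andP: (q01) => q0 q1.
pose I := [set J : {set V} | J \subset [set~ v] & #|J| == k].
pose F (J : {set V}) S : R := (attached [set v] J S)%:R *
  \prod_(e <- cut_edges (v |: J)) ((e \in S) == false)%:R.
have cI (J : {set V}) : J \in I -> v \notin J /\ #|v |: J| = k.+1.
  rewrite inE => /andP[/fintype.subsetP Jv /eqP <-].
  have vJ : v \notin J by apply/negP => /Jv; rewrite !inE eqxx.
  by rewrite cardsU1 vJ.
have le1 : pr (fun S => \sum_(J in I) F J S) <=
    pr (fun S => (k < #|edge_component S v|)%:R).
  apply: wsum_mono => [_|_|S] //; first by rewrite subr_ge0.
  have FE J : F J S = (attached [set v] J S && all (fun e => (e \in S) == false) (cut_edges (v |: J)))%:R.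
    by rewrite /F prod_indic; case: (attached _ _ _); rewrite ?mul1r ?mul0r.
  have F_le J : J \in I -> F J S <= (J == edge_component S v :\ v)%:R.
    move=> JI; have [vJ _] := cI _ JI; rewrite FE ler_nat.
    case: andP => [[h1 h2]|//]; rewrite (edge_component_eq h1 h2).
    by rewrite finset.setU1K // eqxx.
  have [h|h] := ltnP k #|edge_component S v|.
    apply: (@le_trans _ _ (\sum_(J in I) (J == edge_component S v :\ v)%:R)).
      exact: ler_sum.
    rewrite -natr_sum ler_nat.
    rewrite (eq_bigr (fun J => if J == edge_component S v :\ v then 1 else 0)%N); last first.
      by move=> J _; case: (J == _).
    rewrite -big_mkcondr /= sum1_card -(card1 (edge_component S v :\ v)).
    by apply: subset_leq_card; apply/fintype.subsetP => J /andP[].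
  rewrite big1 // => J JI; rewrite FE.
  case: andP => [[h1 h2]|//]; have [_ c] := cI _ JI.
  by move: h; rewrite (edge_component_eq h1 h2) c ltnn.
apply: le_trans le1; rewrite wsum_bigsum.
have <- : #|I| = 'C(#|V|.-1, k) by rewrite cards_draws cardsC1.
rewrite -mulrA mulr_natl -sumr_const; apply: ler_sum => J JI.
have [vJ cJ] := cI _ JI.
rewrite /F (@wsum_indep _ _ _ _ (edges_towards [set v] J) [set e in cut_edges (v |: J)]).
- apply: ler_pM.
  + by rewrite mulr_ge0 // exprn_ge0 // subr_ge0 exprn_ile1 ?subr_ge0 // lerBlDr lerDl.
  + by rewrite exprn_ge0 // subr_ge0.
  + have dJ : [disjoint [set v] & J] by rewrite disjoints1.
    have := attached_ge uL fullL q01 dJ; rewrite finset.cards1.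
    move: JI; rewrite inE => /andP[_ /eqP ->].
    by rewrite add1n mul1r.
  + rewrite wsum_edges //; last 2 first.
    * exact: cut_edges_uniq.
    * move=> e /allpairsP[[x y]] /= []; rewrite !mem_enum finset.in_setC => xJ yJ ->.
      by apply: fullL; apply: contraNneq yJ => <-.
    by rewrite big_const_seq count_predT size_cut_edges cJ iter_mulr_1.
- exact: attached_depends_on.
- exact: depends_on_prod.
rewrite disjoint_sym finset.disjoints_subset; apply/fintype.subsetP => e; rewrite inE.
move=> /allpairsP[[x y]] /= []; rewrite !mem_enum finset.in_setC => xJ yJ ->.
rewrite !inE negb_and; apply/orP; left; apply/negP => /fintype.subsetP/(_ y).
by rewrite finset.set22 => /(_ isT); apply/negP.
Qed.

End ComponentSize.

Local Open Scope classical_set_scope.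
Local Open Scope ring_scope.

(** * The exponential rate and its expansion at zero *)

Section TaylorBounds.
Variable R : realType.
Implicit Types (x y e b : R) (f df : R -> R).

Lemma is_derive_ndecr f df b :
  (forall x, 0 <= x <= b -> is_derive x 1 f (df x)) ->
  (forall x, 0 <= x <= b -> 0 <= df x) ->
  forall x, 0 <= x <= b -> f 0 <= f x.
Proof.
move=> fd df0 x /andP[x0 xb].
have itv z : z \in `]0, b[%R -> 0 <= z <= b.
  by rewrite in_itv /= => /andP[z0 zb]; rewrite !ltW.
apply: (@ger0_derive1_ndecr _ f 0 b) => //.
- by move=> z /itv /fd [].
- move=> z /itv zb; rewrite derive1E.
  by have [_ ->] := fd _ zb; exact: df0.
apply: derivable_within_continuous => z; rewrite in_itv /= => zb.
by have [] := fd _ zb.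
Qed.

Let derD f g x a b : is_derive x 1 f a -> is_derive x 1 g b ->
  is_derive x 1 (fun z : R => f z + g z) (a + b).
Proof. exact: is_deriveD. Qed.

Let derE f x a b : is_derive x 1 f a -> a = b -> is_derive x 1 f b.
Proof. by move=> + <-. Qed.

(** Every Taylor bound below compares a function with a polynomial of degree
    at most four. *)
Lemma is_derive_quartic (a1 a2 a3 a4 : R) x :
  is_derive x 1 (fun z : R => a1 * z + a2 * z ^+ 2 + a3 * z ^+ 3 + a4 * z ^+ 4)
    (a1 + 2 * a2 * x + 3 * a3 * x ^+ 2 + 4 * a4 * x ^+ 3).
Proof.
have h (c : R) n : is_derive x 1 (fun z : R => c * z ^+ n) (c * (n%:R * x ^+ n.-1)).
  have d := @is_deriveX _ _ id n x 1 1 (is_derive_id x 1).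
  have := is_deriveZ c d; rewrite [_ *: 1]mulr1 => {}d.
  rewrite (_ : (fun z : R => c * z ^+ n) = c \*: (id ^+ n : R -> R)) //.
  by apply/funext => z /=; rewrite exprfctE.
have e1 : is_derive x 1 (fun z : R => a1 * z) a1.
  have := h a1 1%N; rewrite /= expr0 !mulr1.
  by rewrite (_ : (fun z : R => a1 * z ^+ 1) = (fun z : R => a1 * z)).
apply: derE (derD (derD (derD e1 (h a2 2%N)) (h a3 3%N)) (h a4 4%N)) _.
by rewrite /=; ring.
Qed.

Lemma is_derive_ln1B x : x < 1 ->
  is_derive x 1 (fun z : R => ln (1 - z)) (- (1 - x)^-1).
Proof.
move=> x1.
have d1 : is_derive x 1 (fun z : R => 1 - z) (-1).
  apply: derE (derD (is_derive_cst (1 : R) x 1) (is_deriveNid x 1)) _.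
  by rewrite add0r.
have x1' : 0 < 1 - x by rewrite subr_gt0.
apply: derE (@is_derive1_comp R (@ln R) (fun z => 1 - z) x _ _ (is_derive1_ln x1') d1) _.
by rewrite mulrN1.
Qed.

Lemma ln1B_le x : 0 <= x < 1 -> ln (1 - x) <= - x - x ^+ 2 / 2 - x ^+ 3 / 3.
Proof.
move=> /andP[x0 x1].
have h z : 0 <= z <= x -> is_derive z 1 (fun z : R => (-1 * z + (- 2^-1) * z ^+ 2 + (- 3^-1) * z ^+ 3 + 0 * z ^+ 4) - ln (1 - z)) (z ^+ 3 / (1 - z)).
  move=> /andP[z0 zx]; have z1 : z < 1 by exact: le_lt_trans x1.
  apply: derE (derD (is_derive_quartic _ _ _ _ z) (is_deriveN (is_derive_ln1B z1))) _.
  by field; lra.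
have h0 z : 0 <= z <= x -> 0 <= z ^+ 3 / (1 - z).
  move=> /andP[z0 zx]; have z1 : z < 1 by exact: le_lt_trans x1.
  by rewrite divr_ge0 ?exprn_ge0 // subr_ge0 ltW.
have := is_derive_ndecr h h0 (x := x); rewrite x0 lexx => /(_ isT).
by rewrite subr0 ln1 !expr0n /=; lra.
Qed.

Lemma ln1B_ge x : 0 <= x <= 2^-1 -> - x - x ^+ 2 / 2 - x ^+ 3 <= ln (1 - x).
Proof.
move=> /andP[x0 x1].
have h z : 0 <= z <= x -> is_derive z 1 (fun z : R => (1 * z + (2^-1) * z ^+ 2 + 1 * z ^+ 3 + 0 * z ^+ 4) + ln (1 - z)) (z ^+ 2 * (2 - 3 * z) / (1 - z)).
  move=> /andP[z0 zx]; have z1 : z < 1 by lra.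
  apply: derE (derD (is_derive_quartic _ _ _ _ z) (is_derive_ln1B z1)) _.
  by field; lra.
have h0 z : 0 <= z <= x -> 0 <= z ^+ 2 * (2 - 3 * z) / (1 - z).
  move=> /andP[z0 zx]; rewrite divr_ge0 ?mulr_ge0 ?sqr_ge0 //; lra.
have := is_derive_ndecr h h0 (x := x); rewrite x0 lexx => /(_ isT).
by rewrite subr0 ln1 !expr0n /=; lra.
Qed.

Let dexp (z : R) : is_derive z 1 (fun z : R => expR (- z)) (- expR (- z)).
Proof.
apply: derE (@is_derive1_comp R (@expR R) -%R z _ _ (is_derive_expR (- z)) (is_deriveNid z 1)) _.
by rewrite mulrN1.
Qed.

Lemma expRN_le x : 0 <= x ->
  expR (- x) <= 1 - x + x ^+ 2 / 2 - x ^+ 3 / 6 + x ^+ 4 / 24.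
Proof.
have e1 (z : R) : 1 - z <= expR (- z) by exact: expR_ge1Dx.
have e2 (z : R) : 0 <= z -> expR (- z) <= 1 - z + z ^+ 2 / 2.
  move=> z0.
  have h y : 0 <= y <= z -> is_derive y 1 (fun z : R => (- 1 * z + 2^-1 * z ^+ 2 + 0 * z ^+ 3 + 0 * z ^+ 4) - expR (- z)) (-1 + y + expR (- y)).
    by move=> _; apply: derE (derD (is_derive_quartic _ _ _ _ y) (is_deriveN (dexp y))) _; field.
  have h0 y : 0 <= y <= z -> 0 <= -1 + y + expR (- y).
    by move=> _; have := e1 y; lra.
  have := is_derive_ndecr h h0 (x := z); rewrite z0 lexx => /(_ isT).
  by rewrite oppr0 expR0 !expr0n /=; lra.
have e3 (z : R) : 0 <= z -> 1 - z + z ^+ 2 / 2 - z ^+ 3 / 6 <= expR (- z).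
  move=> z0.
  have h y : 0 <= y <= z -> is_derive y 1 (fun z : R => (1 * z + (- 2^-1) * z ^+ 2 + 6^-1 * z ^+ 3 + 0 * z ^+ 4) + expR (- z)) (1 - y + y ^+ 2 / 2 - expR (- y)).
    by move=> _; apply: derE (derD (is_derive_quartic _ _ _ _ y) (dexp y)) _; field.
  have h0 y : 0 <= y <= z -> 0 <= 1 - y + y ^+ 2 / 2 - expR (- y).
    by move=> /andP[y0 _]; have := e2 y y0; lra.
  have := is_derive_ndecr h h0 (x := z); rewrite z0 lexx => /(_ isT).
  by rewrite oppr0 expR0 !expr0n /=; lra.
move=> x0.
have h y : 0 <= y <= x -> is_derive y 1 (fun z : R => (- 1 * z + 2^-1 * z ^+ 2 + (- 6^-1) * z ^+ 3 + 24^-1 * z ^+ 4) - expR (- z)) (expR (- y) - (1 - y + y ^+ 2 / 2 - y ^+ 3 / 6)).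
  by move=> _; apply: derE (derD (is_derive_quartic _ _ _ _ y) (is_deriveN (dexp y))) _; field.
have h0 y : 0 <= y <= x -> 0 <= expR (- y) - (1 - y + y ^+ 2 / 2 - y ^+ 3 / 6).
  by move=> /andP[y0 _]; have := e3 y y0; lra.
have := is_derive_ndecr h h0 (x := x); rewrite x0 lexx => /(_ isT).
by rewrite oppr0 expR0 !expr0n /=; lra.
Qed.

(** The exponential cost of a component with [e * n] vertices in the static
    graph of parameter [1 / n]: entropy of the choice of the vertices, absence
    of outgoing edges, and probability of being connected. *)
Definition giant_rate e : R :=
  e * ln e + (1 - e) * ln (1 - e) + e * (1 - e) - e * ln (1 - expR (- e)).

(** The terms of order less than three cancel, and the cubic one is
    [1/6 - 1/24 = 1/8]: the part [1/24] comes from the expansion of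
    [ln ((1 - expR (- e)) / e)], that is from connected graphs with cycles. *)
Lemma giant_rate_le e : 0 < e <= 2^-1 -> giant_rate e <= e ^+ 3 / 8 + e ^+ 4 / 2.
Proof.
move=> /andP[e0 e1].
have e0' := ltW e0.
(* [e * (1 - y)] is the Taylor polynomial of [1 - expR (- e)] *)
pose y := e / 2 - e ^+ 2 / 6 + e ^+ 3 / 24.
have e2 : 0 <= e ^+ 2 by exact: sqr_ge0.
have e3 : 0 <= e ^+ 3 by exact: exprn_ge0.
have e22 : e ^+ 2 <= e * 2^-1 by rewrite expr2; apply: ler_wpM2l.
have e32 : e ^+ 3 <= e ^+ 2 * 2^-1 by rewrite exprSr; apply: ler_wpM2l.
have y0 : 0 <= y by rewrite /y; lra.
have ye : y <= e / 2 by rewrite /y; lra.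
have yh : y <= 2^-1 by lra.
have l1 : ln (1 - e) <= - e - e ^+ 2 / 2 - e ^+ 3 / 3 by apply: ln1B_le; rewrite e0'; lra.
have l2 : - y - y ^+ 2 / 2 - y ^+ 3 <= ln (1 - y) by apply: ln1B_ge; rewrite y0.
have l3 : e * (1 - y) <= 1 - expR (- e).
  by have := expRN_le e0'; rewrite /y; lra.
have ey : 0 < e * (1 - y) by rewrite mulr_gt0 //; lra.
have l4 : ln e + ln (1 - y) <= ln (1 - expR (- e)).
  rewrite -lnM ?posrE //; last by lra.
  by rewrite ler_ln ?posrE //; exact: lt_le_trans l3.
have y2 : y ^+ 2 <= e ^+ 2 / 4.
  by rewrite (_ : e ^+ 2 / 4 = (e / 2) ^+ 2); [rewrite lerXn2r ?nnegrE //; lra|field].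
have y3 : y ^+ 3 <= e ^+ 3 / 8.
  by rewrite (_ : e ^+ 3 / 8 = (e / 2) ^+ 3); [rewrite lerXn2r ?nnegrE //; lra|field].
have l5 : ln e - e / 2 + e ^+ 2 / 24 - e ^+ 3 / 6 <= ln (1 - expR (- e)).
  by apply: le_trans l4; move: l2; rewrite /y in y2 y3 *; lra.
have m1 : (1 - e) * ln (1 - e) <= (1 - e) * (- e - e ^+ 2 / 2 - e ^+ 3 / 3).
  by apply: ler_wpM2l l1; lra.
have m2 : e * (ln e - e / 2 + e ^+ 2 / 24 - e ^+ 3 / 6) <= e * ln (1 - expR (- e)).
  exact: ler_wpM2l l5.
rewrite /giant_rate; move: m1 m2.
have -> : (1 - e) * (- e - e ^+ 2 / 2 - e ^+ 3 / 3) = - e + e ^+ 2 / 2 + e ^+ 3 / 6 + e ^+ 4 / 3 by field.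
have -> : e * (ln e - e / 2 + e ^+ 2 / 24 - e ^+ 3 / 6) = e * ln e - e ^+ 2 / 2 + e ^+ 3 / 24 - e ^+ 4 / 6 by field.
have -> : e * (1 - e) = e - e ^+ 2 by ring.
lra.
Qed.

End TaylorBounds.

(** * Asymptotics of the success probability *)

Section Asymptotics.
Variable R : realType.

Lemma ln_fact_ge n : (0 < n)%N -> n%:R * ln n%:R - n%:R <= ln (n`!%:R : R).
Proof.
case: n => [//|n _]; elim: n => [|n IHn]; first by rewrite (_ : 1`! = 1)%N // ln1 mulr0 sub0r oppr_le0.
rewrite factS natrM lnM ?posrE ?ltr0n ?fact_gt0 //.
apply: le_trans (lerD (lexx _) IHn).
have n0 : (0 : R) < n.+1%:R by rewrite ltr0n.
have h : ln n.+2%:R <= ln n.+1%:R + (n.+1%:R)^-1 :> R.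
  have -> : n.+2%:R = n.+1%:R * (1 + (n.+1%:R)^-1) :> R.
    by rewrite mulrDr mulr1 divff ?natr1 // gt_eqF.
  have i0 : 0 < (n.+1%:R)^-1 :> R by rewrite invr_gt0.
  by rewrite lnM ?posrE ?addr_gt0 // lerD2l le_ln1Dx // (lt_trans _ i0) // ltrN10.
have := ler_wpM2l (ltW n0) h; rewrite mulrDr divff ?gt_eqF //.
have -> : n.+2%:R = n.+1%:R + 1 :> R by rewrite natr1.
move: (n.+1%:R) => m; move: (ln (m + 1)) (ln m) => u v; lra.
Qed.

Lemma ln_fact_le n : (0 < n)%N ->
  ln (n`!%:R : R) <= 1 + ln n%:R + n%:R * ln n%:R - n%:R.
Proof.
case: n => [//|n _]; elim: n => [|n IHn]; first by rewrite (_ : 1`! = 1)%N // ln1; lra.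
rewrite factS natrM lnM ?posrE ?ltr0n ?fact_gt0 //.
apply: le_trans (lerD (lexx _) IHn) _.
have n0 : (0 : R) < n.+2%:R by rewrite ltr0n.
have n1 : (0 : R) < n.+1%:R by rewrite ltr0n.
have h : ln n.+1%:R <= ln n.+2%:R - (n.+2%:R)^-1 :> R.
  have -> : n.+1%:R = n.+2%:R * (1 + - (n.+2%:R)^-1) :> R.
    by rewrite mulrDr mulr1 mulrN divff ?gt_eqF // -[n.+2%:R]natr1 addrK.
  have i1 : (n.+2%:R)^-1 < 1 :> R by rewrite invf_lt1 // ltr1n.
  rewrite lnM ?posrE ?subr_gt0 // lerD2l le_ln1Dx //.
  by rewrite ltrN2.
have := ler_wpM2l (ltW n0) h; rewrite mulrBr divff ?gt_eqF //.
have -> : n.+2%:R = n.+1%:R + 1 :> R by rewrite natr1.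
move: (n.+1%:R) => m; move: (ln (m + 1)) (ln m) => u v; lra.
Qed.

Lemma ln_bin_ge n k : (0 < k < n)%N ->
  n%:R * ln n%:R - k%:R * ln k%:R - (n - k)%:R * ln (n - k)%:R - 2 - 2 * ln n%:R
  <= ln ('C(n, k)%:R : R).
Proof.
move=> /andP[k0 kn]; have kn' := ltnW kn.
have nk0 : (0 < n - k)%N by rewrite subn_gt0.
have n0 : (0 < n)%N by exact: leq_trans kn.
have := bin_fact kn' => /(congr1 (fun m => ln (m%:R : R))).
rewrite !natrM !lnM ?posrE ?mulr_gt0 ?ltr0n ?fact_gt0 ?bin_gt0 // => E.
have lk : ln k%:R <= ln n%:R :> R by rewrite ler_ln ?posrE ?ltr0n // ler_nat.
have lnk : ln (n - k)%:R <= ln n%:R :> R by rewrite ler_ln ?posrE ?ltr0n // ler_nat leq_subr.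
have := ln_fact_ge n0; have := ln_fact_le k0; have := ln_fact_le nk0.
have : (n - k)%:R = n%:R - k%:R :> R by rewrite natrB.
lra.
Qed.

(** The lower bound of [edge_component_size_ge] for a component with [k + 1]
    vertices among [n]. *)
Definition giant_prob (n k : nat) (q : R) : R :=
  'C(n.-1, k)%:R * (k.+1%:R^-1 * (1 - (1 - q) ^+ k.+1) ^+ k)
    * (1 - q) ^+ (k.+1 * (n - k.+1)).

Lemma giant_prob_gt0 n k (q : R) : (k < n)%N -> 0 < q < 1 -> 0 < giant_prob n k q.
Proof.
move=> kn /andP[q0 q1].
have q0' : 0 < 1 - q by rewrite subr_gt0.
rewrite /giant_prob !mulr_gt0 ?exprn_gt0 ?invr_gt0 ?ltr0n ?bin_gt0 //.
  by case: n kn.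
by rewrite subr_gt0 exprn_ilt1 ?ltW // gtrBl.
Qed.

(** All terms are written with [x = (k + 1) / n] and [y = n ln (1 - q)],
    which converge, so that the limit of the bound divided by [n] can be read
    off. *)
Lemma ln_giant_prob_ge n k (q : R) (x := k.+1%:R / n%:R) (y := n%:R * ln (1 - q)) :
  (k.+1 < n)%N -> 0 < q < 1 ->
  - (x * ln x + (1 - x) * ln (1 - x)) * n%:R - 2 - 3 * ln n%:R
  + (x * n%:R - 1) * ln (1 - expR (x * y)) + x * (1 - x) * y * n%:R
  <= ln (giant_prob n k q).
Proof.
move=> kn /andP[q0 q1].
have n0 : (0 < n)%N by exact: leq_trans kn.
have nR : (0 : R) < n%:R by rewrite ltr0n.
have q0' : 0 < 1 - q by rewrite subr_gt0.
have q1' : 1 - q < 1 by rewrite gtrBl.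
have kR : (0 : R) < k.+1%:R by rewrite ltr0n.
have xn : x * n%:R = k.+1%:R by rewrite /x divfK // gt_eqF.
have x0 : 0 < x by rewrite divr_gt0.
have x1 : 0 < 1 - x by rewrite subr_gt0 ltr_pdivrMr // mul1r ltr_nat.
have nk : (n - k.+1)%:R = (1 - x) * n%:R by rewrite natrB 1?ltnW // mulrBl mul1r xn.
clearbody x.
have zE : (1 - q) ^+ k.+1 = expR (x * y).
  by rewrite /y mulrA xn mulrC expRM_natr lnK ?posrE.
have z1 : 0 < 1 - expR (x * y) by rewrite -zE subr_gt0 exprn_ilt1 ?ltW.
have binE : 'C(n.-1, k)%:R = x * 'C(n, k.+1)%:R :> R.
  apply: (mulfI (lt0r_neq0 nR)); rewrite mulrA [n%:R * x]mulrC xn -!natrM.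
  by rewrite mul_bin_diag.
rewrite /giant_prob binE zE.
have b0 : 0 < ('C(n, k.+1)%:R : R) by rewrite ltr0n bin_gt0 ltnW.
rewrite !lnM ?posrE ?mulr_gt0 ?exprn_gt0 ?invr_gt0 //.
rewrite lnV ?posrE // !lnXn // -(mulr_natr _ k) -[X in _ <= _ + X]mulr_natr natrM nk.
have kE : k%:R = x * n%:R - 1 by rewrite xn -natr1 addrK.
have lkn : ln (k.+1%:R : R) = ln x + ln n%:R by rewrite -xn lnM ?posrE.
have := @ln_bin_ge n k.+1 kn.
rewrite nk lnM ?posrE // lkn kE -xn.
by rewrite /y; lra.
Qed.

End Asymptotics.

Section Limits.
Variable R : realType.

Lemma cvg_invn : (n%:R^-1 : R) @[n --> \oo] --> 0.
Proof.
rewrite -(cvg_shiftS (fun n => n%:R^-1 : R)); exact: cvg_harmonic.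
Qed.

(** From the tangent of the concave function [ln] at [1 / c]; the slope [c] can
    be as small as desired, so [ln n / n] tends to zero. *)
Lemma ln_le_lin (c x : R) : 0 < c -> 0 < x -> ln x <= c * x - ln c.
Proof.
move=> c0 x0; have := @le_ln1Dx _ (c * x - 1).
have cx := mulr_gt0 c0 x0.
rewrite [1 + _]addrC subrK lnM ?posrE // => /(_ _); lra.
Qed.

Lemma cvg_ln_invn : (ln n%:R / n%:R : R) @[n --> \oo] --> 0.
Proof.
apply/cvgrPdist_le => e e0.
have e2 : 0 < e / 3 by rewrite divr_gt0.
have h : (- ln (e / 3) * n%:R^-1 : R) @[n --> \oo] --> 0.
  rewrite -[X in _ --> X](mulr0 (- ln (e / 3))).
  by apply: cvgM; [exact: cvg_cst|exact: cvg_invn].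
move/cvgrPdist_le : h => /(_ _ e2) h.
near=> n.
have n0 : (0 : R) < n%:R.
  by rewrite ltr0n; near: n; exact: nbhs_infty_gt.
have l0 : 0 <= ln n%:R :> R by rewrite ln_ge0 // ler1n -(ltr0n R).
rewrite sub0r normrN ger0_norm ?divr_ge0 ?(ltW n0) //.
have : `|0 - - ln (e / 3) * n%:R^-1| <= e / 3 by near: n.
rewrite sub0r normrN => /(le_trans (ler_norm _)) H.
have i0 : (0 : R) <= n%:R^-1 by rewrite invr_ge0 ltW.
have := ler_wpM2r i0 (ln_le_lin e2 n0).
rewrite mulrBl mulfK ?gt_eqF //.
move: H; rewrite mulNr => H. lra.
Unshelve. all: by end_near.
Qed.

(** The factor besides [1 / n] accounts for an edge that appears late or
    disappears too early between two inspections; it tends to [1]. See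
    [step_prob_trials]. *)
Definition step_prob (n : nat) : R :=
  expR (- (ln n%:R / n.-1%:R + ln n%:R / n%:R)) / n%:R.

Lemma cvg_ln_invpredn : (ln n%:R / n.-1%:R : R) @[n --> \oo] --> 0.
Proof.
have h2 : (2 * (ln n%:R / n%:R) : R) @[n --> \oo] --> 0.
  rewrite -[X in _ --> X](mulr0 2); apply: cvgM; [exact: cvg_cst|exact: cvg_ln_invn].
apply: (squeeze_cvgr _ (cvg_cst (0 : R)) h2).
near=> n.
have n1 : (1 < n)%N by near: n; exact: nbhs_infty_gt.
have n0 : (0 : R) < n%:R by rewrite ltr0n ltnW.
have m0 : (0 : R) < n.-1%:R by rewrite ltr0n; lia.
have l0 : 0 <= ln n%:R :> R by rewrite ln_ge0 // ler1n ltnW.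
rewrite divr_ge0 ?(ltW m0) //= mulrCA; apply: ler_wpM2l => //.
rewrite ler_pdivlMr // mulrC ler_pdivrMr // -natrM ler_nat; lia.
Unshelve. all: by end_near.
Qed.

Lemma cvg_step_prob : (n%:R * step_prob n : R) @[n --> \oo] --> (1 : R).
Proof.
have h : (expR (- (ln n%:R / n.-1%:R + ln n%:R / n%:R)) : R) @[n --> \oo] --> (1 : R).
  rewrite -[X in _ --> X]expR0 -[X in expR X]oppr0 -[X in - X]addr0.
  apply: continuous_cvg; first exact: continuous_expR.
  by apply: cvgN; apply: cvgD; [exact: cvg_ln_invpredn|exact: cvg_ln_invn].
apply: cvg_trans h; apply: near_eq_cvg; near=> n.
have n0 : (0 : R) < n%:R by rewrite ltr0n; near: n; exact: nbhs_infty_gt.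
by rewrite /step_prob mulrCA divff ?mulr1 // gt_eqF.
Unshelve. all: by end_near.
Qed.

Lemma step_prob_itv n : (1 < n)%N -> 0 < step_prob n < 1.
Proof.
move=> n1; have n0 : (0 : R) < n%:R by rewrite ltr0n ltnW.
rewrite divr_gt0 ?expR_gt0 //= ltr_pdivrMr // mul1r.
apply: (@le_lt_trans _ _ 1); last by rewrite ltr1n.
have l0 : 0 <= ln n%:R :> R by rewrite ln_ge0 // ler1n ltnW.
by rewrite expR_le1 oppr_le0 addr_ge0 // divr_ge0.
Qed.

Lemma cvg_ln_step_prob : (n%:R * ln (1 - step_prob n) : R) @[n --> \oo] --> (-1 : R).
Proof.
have q0 : (step_prob n : R) @[n --> \oo] --> 0.
  have h : (n%:R * step_prob n * n%:R^-1 : R) @[n --> \oo] --> (0 : R).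
    by rewrite -[X in _ --> X](mulr0 1); exact: cvgM cvg_step_prob cvg_invn.
  apply: cvg_trans h; apply: near_eq_cvg; near=> n.
  have n0 : (0 : R) < n%:R by rewrite ltr0n; near: n; exact: nbhs_infty_gt.
  by rewrite mulrC mulKf // gt_eqF.
have up : (- (n%:R * step_prob n) : R) @[n --> \oo] --> (-1 : R).
  by apply: cvgN; exact: cvg_step_prob.
have lo : (- (n%:R * step_prob n) / (1 - step_prob n) : R) @[n --> \oo] --> (-1 : R).
  rewrite -[X in _ --> X]divr1 -[X in _ / X]subr0.
  apply: cvgM => //; apply: cvgV; first by rewrite subr0 oner_eq0.
  by apply: cvgB => //; exact: cvg_cst.
apply: (squeeze_cvgr _ lo up); near=> n.
have n1 : (1 < n)%N by near: n; exact: nbhs_infty_gt.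
have n0 : (0 : R) <= n%:R by rewrite ler0n.
have /andP[s0 s1] := step_prob_itv n1.
set s := step_prob n in s0 s1 *.
rewrite -mulrN -mulrA; apply/andP; split; apply: ler_wpM2l => //.
  have r0 : 0 < 1 - s by rewrite subr_gt0.
  have := @le_ln1Dx R (s / (1 - s)).
  have -> : 1 + s / (1 - s) = (1 - s)^-1 by field; rewrite gt_eqF.
  rewrite lnV ?posrE // mulNr => h.
  rewrite lerNl; apply: h.
  by rewrite (lt_trans (ltrN10 _)) // divr_gt0.
by apply: le_ln1Dx; rewrite ltrN2.
Unshelve. all: by end_near.
Qed.

Lemma cvg_frac (e : R) : 0 < e -> 
  ((Num.truncn (e * n%:R)).+1%:R / n%:R : R) @[n --> \oo] --> e.
Proof.
move=> e0.
have up : (e + n%:R^-1 : R) @[n --> \oo] --> e.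
  by rewrite -[X in _ --> X]addr0; apply: cvgD; [exact: cvg_cst|exact: cvg_invn].
apply: (squeeze_cvgr _ (cvg_cst e) up); near=> n.
have n0 : (0 : R) < n%:R by rewrite ltr0n; near: n; exact: nbhs_infty_gt.
have en : 0 <= e * n%:R by rewrite mulr_ge0 ?ltW.
have /andP[h1 h2] := truncn_itv en.
rewrite ler_pdivlMr // ltW //= ler_pdivrMr // mulrDl mulVf ?gt_eqF //.
by rewrite -natr1 lerD2r.
Unshelve. all: by end_near.
Qed.

Lemma giant_prob_rate (alpha e : R) : 0 < alpha -> 0 < e < 1 ->
  exists h : nat -> R, (h n / n%:R @[n --> \oo] --> 0) /\
  exists N, forall n, (N <= n)%N ->
    (Num.truncn (e * n%:R) < n)%N /\
    ln n%:R / alpha / giant_prob n (Num.truncn (e * n%:R)) (step_prob n)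
      <= expR (n%:R * giant_rate e + h n).
Proof.
move=> a0 /andP[e0 e1].
pose x (n : nat) : R := (Num.truncn (e * n%:R)).+1%:R / n%:R.
pose y (n : nat) : R := n%:R * ln (1 - step_prob n).
pose F (n : nat) : R := ln n%:R / n%:R + - ln alpha * n%:R^-1
  + (x n * ln (x n) + (1 - x n) * ln (1 - x n)) + 2 * n%:R^-1
  + 3 * (ln n%:R / n%:R) - (x n - n%:R^-1) * ln (1 - expR (x n * y n))
  - x n * (1 - x n) * y n.
have cx : x n @[n --> \oo] --> e by exact: cvg_frac.
have cx1 : (1 - x n : R) @[n --> \oo] --> 1 - e by apply: cvgB => //; exact: cvg_cst.
have cy : y n @[n --> \oo] --> (-1 : R) by exact: cvg_ln_step_prob.
have cl (u : nat -> R) (l : R) : 0 < l -> u n @[n --> \oo] --> l ->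
    ln (u n) @[n --> \oo] --> ln l.
  by move=> l0 ul; apply: continuous_cvg => //; exact: continuous_ln.
have ce : (1 - expR (x n * y n)) @[n --> \oo] --> 1 - expR (- e).
  apply: cvgB; first exact: cvg_cst.
  apply: continuous_cvg; first exact: continuous_expR.
  by rewrite -mulrN1; exact: cvgM.
have cF : F n @[n --> \oo] --> giant_rate e.
  have -> : giant_rate e = 0 + - ln alpha * 0 + (e * ln e + (1 - e) * ln (1 - e))
     + 2 * 0 + 3 * 0 - (e - 0) * ln (1 - expR (- e)) - e * (1 - e) * -1.
    by rewrite /giant_rate; ring.
  have c (a : R) : a @[n --> \oo] --> a by exact: cvg_cst.
  have ci := cvg_invn; have cli := cvg_ln_invn.
  have e0' : 0 < 1 - e by rewrite subr_gt0.
  have e0'' : 0 < 1 - expR (- e) by rewrite subr_gt0 expR_lt1 oppr_lt0.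
  have c1 := cl _ _ e0 cx; have c2 := cl _ _ e0' cx1; have c3 := cl _ _ e0'' ce.
  apply: cvgB; last by apply: cvgM => //; exact: cvgM.
  apply: cvgB; last by apply: cvgM => //; exact: cvgB.
  apply: cvgD; last exact: cvgM.
  apply: cvgD; last exact: cvgM.
  apply: cvgD; last by apply: cvgD; exact: cvgM.
  by apply: cvgD => //; exact: cvgM.
exists (fun n => n%:R * (F n - giant_rate e)); split.
  have h : (F n - giant_rate e) @[n --> \oo] --> 0.
    by rewrite -[X in _ --> X](subrr (giant_rate e)); apply: cvgB => //; exact: cvg_cst.
  apply: cvg_trans h; apply: near_eq_cvg; near=> n.
  have n0 : (0 : R) < n%:R by rewrite ltr0n; near: n; exact: nbhs_infty_gt.
  by rewrite mulrAC divff ?mul1r // gt_eqF.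
(* [x n < 1] leaves a vertex outside, as the bound on binomials requires *)
have [N _ HN] : \forall n \near \oo, x n < 1 /\ (2 < n)%N.
  near=> n; split; last by near: n; exact: nbhs_infty_gt.
  by near: n; exact: (cvgr_lt e).
exists N => n /HN [xn n2].
have n0 : (0 : R) < n%:R by rewrite ltr0n; lia.
have kn : ((Num.truncn (e * n%:R)).+1 < n)%N.
  by move: xn; rewrite /x ltr_pdivrMr // mul1r ltr_nat.
split; first exact: ltnW.
have q01 : 0 < (step_prob n : R) < 1 by apply: step_prob_itv; lia.
set k := Num.truncn _ in kn *; set q := step_prob n in q01 *.
have p0 := giant_prob_gt0 (ltnW kn) q01.
have l1 : 0 < ln n%:R :> R by rewrite ln_gt0 // ltr1n; lia.
rewrite -[leLHS]lnK ?posrE ?divr_gt0 // ler_expR.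
rewrite ln_div ?posrE ?divr_gt0 // ln_div ?posrE //.
have := ln_giant_prob_ge kn q01; rewrite -/(x n) -/(y n) => H.
(* the factor [ln n] of [T] is bounded crudely, by [n] *)
have lnln : ln (ln n%:R) <= ln n%:R :> R by apply: ltW; apply: ln_sublinear.
have -> : n%:R * giant_rate e + n%:R * (F n - giant_rate e) = n%:R * F n by ring.
have -> : n%:R * F n = ln n%:R + - ln alpha
  + (x n * ln (x n) + (1 - x n) * ln (1 - x n)) * n%:R + 2 
  + 3 * ln n%:R - (x n * n%:R - 1) * ln (1 - expR (x n * y n))
  - x n * (1 - x n) * y n * n%:R.
  by rewrite /F; field; rewrite gt_eqF.
move: H lnln; lra.
Unshelve. all: by end_near.
Qed.

End Limits.

(** * Grouping independent random variables *)

Section Independence.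
Context (R : realType) (d : measure_display) (Om : measurableType d)
  (P : probability Om R) (I : choiceType) (X : I -> {RV P >-> R}).
Implicit Types (Q : pred I) (B F G : set Om).

(** A pi-system that generates the events determined by the variables with
    index in [Q], and on which the product rule is the assumption. *)
Definition cylinders Q : set (set Om) :=
  [set B | exists J (A : I -> set R), [/\ uniq J, all Q J,
     (forall i, measurable (A i)) &
     B = \bigcap_(i in [set` J]) (X i @^-1` A i)]].

(** The events determined by the variables whose index satisfies [Q]. *)
Definition events_of Q : set (set Om) := <<s cylinders Q >>.

Lemma cylinders_measurable Q : cylinders Q `<=` measurable.
Proof.
move=> _ [J [A [_ _ mA ->]]]; apply: fin_bigcap_measurable => // i _.
by rewrite -[X in measurable X]setTI; exact: measurable_funPT.
Qed.

Lemma cylindersT Q : cylinders Q setT.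
Proof.
exists [::], (fun=> setT); split => //; rewrite (_ : [set` [::]] = set0) ?bigcap_set0 //.
by apply/seteqP; split.
Qed.

Lemma cylindersI Q : setI_closed (cylinders Q).
Proof.
move=> _ _ [J1 [A1 [u1 q1 m1 ->]]] [J2 [A2 [u2 q2 m2 ->]]].
pose A i := (if i \in J1 then A1 i else setT) `&` (if i \in J2 then A2 i else setT).
exists (undup (J1 ++ J2)), A; split.
- exact: undup_uniq.
- apply/allP => i; rewrite mem_undup mem_cat.
  by case/orP => [/(allP q1)|/(allP q2)].
- by move=> i; apply: measurableI; case: ifP.
apply/seteqP; split => [w [h1 h2] i|w h].
  rewrite /= mem_undup mem_cat => _; split => /=; case: ifPn => // iJ.
  - exact: h1.
  - exact: h2.
split => i /= iJ; have := h i; rewrite /= mem_undup mem_cat iJ ?orbT => /(_ isT) [/=].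
  by rewrite iJ.
by rewrite iJ.
Qed.

Lemma cylinders_sub Q Q' : (forall i, Q i -> Q' i) -> cylinders Q `<=` cylinders Q'.
Proof.
move=> QQ _ [J [A [u q m ->]]]; exists J, A; split => //.
by apply/allP => i /(allP q) /QQ.
Qed.

Lemma events_of_measurable Q F : events_of Q F -> measurable F.
Proof.
by apply: smallest_sub; [exact: sigma_algebra_measurable|exact: cylinders_measurable].
Qed.

Lemma cylinders_events Q F : cylinders Q F -> events_of Q F.
Proof. exact: sub_sigma_algebra. Qed.

Lemma events_of_sub Q Q' : (forall i, Q i -> Q' i) -> events_of Q `<=` events_of Q'.
Proof.
move=> QQ; apply: smallest_sub; first exact: smallest_sigma_algebra.
by move=> F /(cylinders_sub QQ) /cylinders_events.
Qed.

(** Both sides of the product rule are finite measures in [F], so it is enough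
    to check it on a generating pi-system. *)
Lemma indep_extend (C : set (set Om)) (B : set Om) :
  C `<=` measurable -> setI_closed C -> C setT -> measurable B ->
  (forall F, C F -> P (F `&` B) = (P F * P B)%E) ->
  forall F, <<s C >> F -> P (F `&` B) = (P F * P B)%E.
Proof.
move=> Cm CI CT mB h F CF.
have PB : (0 <= fine (P B))%R by rewrite fine_ge0.
pose m1 := mrestr P mB.
pose m2 := mscale (NngNum PB) P.
have m1E A : m1 A = P (A `&` B) by [].
have m2E A : m2 A = (P A * P B)%E.
  by rewrite /m2 /mscale /= muleC fineK // fin_num_measure.
rewrite -m1E -m2E.
apply: (g_sigma_algebra_measure_unique C _ (fun=> setT)) => //.
- by rewrite bigcup_const //; exists 0%N.
- by move=> A CA; have := h A CA; rewrite -(m1E A) -(m2E A).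
- move=> _; have := probability_le1 P mB.
  by rewrite -[X in P X]setTI -(m1E setT) => /le_lt_trans; apply; exact: ltry.
Qed.

Hypothesis indX : mutually_independent X.

Lemma cylinders_indep Q Q' B B' : (forall i, Q i -> ~~ Q' i) ->
  cylinders Q B -> cylinders Q' B' -> P (B `&` B') = (P B * P B')%E.
Proof.
move=> QQ [J1 [A1 [u1 q1 m1 ->]]] [J2 [A2 [u2 q2 m2 ->]]].
have dis i : i \in J2 -> i \notin J1.
  by move=> /(allP q2) h; apply/negP => /(allP q1) /QQ; rewrite h.
pose A i := if i \in J1 then A1 i else A2 i.
have -> : (\bigcap_(i in [set` J1]) (X i @^-1` A1 i)) `&` (\bigcap_(i in [set` J2]) (X i @^-1` A2 i))
   = \bigcap_(i in [set` J1 ++ J2]) (X i @^-1` A i).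
  apply/seteqP; split => [w [h1 h2] i|w h].
    rewrite /= mem_cat /A; case: ifP => [iJ _|_ /= iJ]; [exact: h1|exact: h2].
  split => i /= iJ; have := h i; rewrite /= mem_cat iJ ?orbT /A => /(_ isT).
    by rewrite iJ.
  by rewrite (negbTE (dis _ iJ)).
rewrite !indX //; last 2 first.
- rewrite cat_uniq u1 u2 andbT /=; apply/hasPn => i /dis; exact.
- by move=> i; rewrite /A; case: ifP.
rewrite big_cat /=; congr (_ * _)%E; apply: eq_big_seq => i iJ; rewrite /A.
  by rewrite iJ.
by rewrite (negbTE (dis _ iJ)).
Qed.

(** The groups are replaced one at a time: for fixed events of the other
    groups, [indep_extend] passes from cylinders to all events of the group at
    hand. *)
Lemma groups_indep_cyl (K : eqType) (gs : seq K) (Q : K -> pred I) (F : K -> set Om) Q' B :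
  uniq gs ->
  (forall g g' i, g \in gs -> g' \in gs -> Q g i -> Q g' i -> g = g') ->
  (forall g i, g \in gs -> Q g i -> ~~ Q' i) ->
  (forall g, g \in gs -> events_of (Q g) (F g)) ->
  cylinders Q' B ->
  P ((\bigcap_(g in [set` gs]) F g) `&` B) = (\prod_(g <- gs) P (F g) * P B)%E.
Proof.
elim: gs Q' B => [|g gs IH] Q' B /=.
  move=> _ _ _ _ _; rewrite big_nil mul1e (_ : [set` [::]] = set0) ?bigcap_set0 ?setTI //.
  by apply/seteqP; split.
case/andP => ggs ugs dQ dQ' mF cB.
have mF' g' : g' \in gs -> events_of (Q g') (F g').
  by move=> h; apply: mF; rewrite inE h orbT.
have dQ1 g1 g2 i : g1 \in gs -> g2 \in gs -> Q g1 i -> Q g2 i -> g1 = g2.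
  by move=> h1 h2; apply: dQ; rewrite inE ?h1 ?h2 orbT.
have dQ1' g1 i : g1 \in gs -> Q g1 i -> ~~ Q' i.
  by move=> h1; apply: dQ'; rewrite inE h1 orbT.
rewrite big_cons.
set S := \bigcap_(g' in [set` gs]) F g'.
have -> : \bigcap_(g' in [set` g :: gs]) F g' = F g `&` S.
  apply/seteqP; split => [w h|w [h1 h2] g' /=].
    split; first by apply: h; rewrite /= inE eqxx.
    by move=> g' /= g'gs; apply: h; rewrite /= inE g'gs orbT.
  by rewrite inE => /orP[/eqP ->//|]; exact: h2.
have mS : measurable S.
  by apply: fin_bigcap_measurable => // g' /= /mF' /events_of_measurable.
have mB := cylinders_measurable cB.
rewrite -setIA -muleA -(IH Q' B) //.
apply: (@indep_extend (cylinders (Q g))).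
- exact: cylinders_measurable.
- exact: cylindersI.
- exact: cylindersT.
- exact: measurableI.
- move=> G cG; rewrite -/S setICA.
  have dgQ' i : Q g i -> ~~ Q' i by apply: dQ'; rewrite inE eqxx.
  have cGB : cylinders (predU (Q g) Q') (G `&` B).
    apply: cylindersI.
      by apply: cylinders_sub cG => i /= ->.
    by apply: cylinders_sub cB => i /= ->; rewrite orbT.
  rewrite (IH _ _ ugs dQ1 _ mF' cGB); last first.
    move=> g' i g'gs Qi; rewrite /= negb_or (dQ1' g' i) // andbT.
    apply/negP => Qgi; move: ggs.
    by rewrite (dQ g g' i) ?g'gs ?inE ?eqxx ?g'gs ?orbT.
  rewrite (IH _ _ ugs dQ1 dQ1' mF' cB).
  by rewrite (cylinders_indep dgQ' cG cB) muleCA.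
- by apply: mF; rewrite inE eqxx.
Qed.

Lemma groups_indep (K : eqType) (gs : seq K) (Q : K -> pred I) (F : K -> set Om) :
  uniq gs ->
  (forall g g' i, g \in gs -> g' \in gs -> Q g i -> Q g' i -> g = g') ->
  (forall g, g \in gs -> events_of (Q g) (F g)) ->
  P (\bigcap_(g in [set` gs]) F g) = (\prod_(g <- gs) P (F g))%E.
Proof.
move=> ugs dQ mF; have := @groups_indep_cyl _ gs Q F (fun=> false) setT ugs dQ.
rewrite setIT probability_setT mule1; apply => //; exact: cylindersT.
Qed.

Lemma events_indep Q Q' F F' : (forall i, Q i -> ~~ Q' i) ->
  events_of Q F -> events_of Q' F' -> P (F `&` F') = (P F * P F')%E.
Proof.
move=> QQ eF eF'.
have := @groups_indep _ [:: true; false] (fun b => if b then Q else Q')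
   (fun b => if b then F else F').
rewrite !big_cons big_nil mule1 => <- //; last 2 first.
- by case=> [] [] i _ _ // h1 h2; have := QQ i; rewrite h1 h2 => /(_ isT).
- by case.
congr (P _); apply/seteqP; split => [w [h1 h2] []//|w h].
by split; [exact: (h true)|exact: (h false)].
Qed.

End Independence.

(** * Exponential laws and memorylessness *)

Section Memoryless.
Context (R : realType).

Lemma exponential_neg (r : R) : 0 < r -> exponential_prob r `]-oo, 0[ = 0%E.
Proof.
move=> r0; rewrite /exponential_prob integral0_eq // => x /=.
rewrite in_itv /= => x0.
by rewrite /exponential_pdf patchE ifF //= memNset //= in_itv /= andbT; apply/negP; rewrite -ltNge.
Qed.

Lemma exponential_tail (d : measure_display) (Om : measurableType d)
    (P : probability Om R) (Z : {RV P >-> R}) (r x : R) :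
  0 < r -> has_exponential_law r Z -> 0 <= x ->
  distribution P Z `]x, +oo[ = (expR (- r * x))%:E.
Proof.
move=> r0 lawZ x0.
have h0x : exponential_prob r `[0, x] = (1 - (expR (- r * x))%:E)%E.
  move: x0; rewrite le_eqVlt => /orP[/eqP <-|]; last exact: exponential_prob_itv0c.
  by rewrite mulr0 expR0 subee // set_itv1 /exponential_prob integral_set1.
have hx : distribution P Z `]-oo, x] = (1 - (expR (- r * x))%:E)%E.
  have -> : `]-oo, x]%classic = `]-oo, 0[ `|` `[0, x] :> set R.
    apply/seteqP; split => y /=; rewrite !in_itv /=.
      by have [y0|y0] := ltP y 0; [left|right].
    by move=> [y0|/andP[]//]; exact: le_trans (ltW y0) x0.
  rewrite measureU //; last first.
    apply/seteqP; split => y //=; rewrite !in_itv /= => -[y0 /andP[y1 _]].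
    by move: (lt_le_trans y0 y1); rewrite ltxx.
  apply: etrans (congr2 (fun a b => (a + b)%E) (lawZ _ (measurable_itv _)) (lawZ _ (measurable_itv _))) _.
  by rewrite exponential_neg // add0e h0x.
rewrite -setCitvl.
apply: etrans (probability_setC (distribution P Z) (measurable_itv `]-oo, x])) _.
apply: etrans (congr1 (fun a => (1 - a)%E) hx) _.
by rewrite -!EFinB opprB addrC subrK.
Qed.

Lemma exponential_ge0 (d : measure_display) (Om : measurableType d)
    (P : probability Om R) (Z : {RV P >-> R}) (r : R) :
  0 < r -> has_exponential_law r Z -> P [set w | Z w < 0] = 0%E.
Proof.
move=> r0 lawZ; have := lawZ `]-oo, 0[%classic (measurable_itv _).
by rewrite exponential_neg // => <-; congr (P _).
Qed.

Section TwoVariables.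
Context (d : measure_display) (Om : measurableType d) (P : probability Om R).
Variables Y Z : {RV P >-> R}.
Hypothesis indYZ : forall A B, measurable A -> measurable B ->
  P (Y @^-1` A `&` Z @^-1` B) = (P (Y @^-1` A) * P (Z @^-1` B))%E.

(** Uniqueness of the product measure, followed by integration over
    sections. *)
Lemma independent_pair_law (C : set (R * R)) : measurable C ->
  P [set w | C (Y w, Z w)] =
  (\int[distribution P Y]_y distribution P Z (xsection C y))%E.
Proof.
move=> mC.
have mYZ : measurable_fun setT (fun w => (Y w, Z w)).
  exact: measurable_fun_pair.
pose W : {mfun Om >-> (R * R)%type} := HB.pack (fun w => (Y w, Z w))
  (isMeasurableFun.Build _ _ _ _ (fun w => (Y w, Z w)) mYZ).
have := @product_measure_unique _ _ _ _ _ (distribution P Y) (distribution P Z)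
  (distribution P W) _ C mC.
by move=> H; apply: esym; apply: H => A B mA mB; exact: indYZ.
Qed.

(** For a fixed value [y <= s] of [Y], both sides are tails of the exponential
    law, at [s + t - y] and at [s - y]. *)
Lemma memoryless_pair (r s t : R) : 0 < r -> has_exponential_law r Z -> 0 <= t ->
  P [set w | Y w <= s /\ s + t < Y w + Z w] =
  ((expR (- r * t))%:E * P [set w | (Y w <= s)%R /\ (s < Y w + Z w)%R])%E.
Proof.
move=> r0 lawZ t0.
pose C (u : R) := [set yz : R * R | yz.1 <= s /\ s + u < yz.1 + yz.2].
have mC u : measurable (C u).
  have -> : C u = [set yz : R * R | yz.1 <= s] `&` [set yz : R * R | s + u < yz.1 + yz.2] by [].
  apply: measurableI; rewrite -[X in measurable X]setTI.
    have mf : measurable_fun setT (@fst R R) by exact: measurable_fst.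
    have := mf measurableT `]-oo, s]%classic (measurable_itv _).
    by congr (measurable _); apply/seteqP; split => x /=; rewrite in_itv.
  have mf : measurable_fun setT (fun yz : R * R => yz.1 + yz.2).
    by apply: measurable_realfun.measurable_funD; [exact: measurable_fst|exact: measurable_snd].
  have := mf measurableT `]s + u, +oo[%classic (measurable_itv _).
  by congr (measurable _); apply/seteqP; split => x /=; rewrite in_itv /= andbT.
have sec u y : 0 <= u -> distribution P Z (xsection (C u) y) =
   if y <= s then (expR (- r * (s + u - y)))%:E else 0%E.
  move=> u0; case: ifPn => ys.
    have uy : 0 <= s + u - y by lra.
    rewrite -(exponential_tail r0 lawZ uy); congr (distribution P Z _).
    apply/seteqP; split => z /=.
      by rewrite /xsection /= inE /C /= in_itv /= andbT => -[_]; lra.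
    by rewrite /xsection /= inE /C /= in_itv /= andbT; split => //; lra.
  rewrite (_ : xsection _ _ = set0) ?measure0 //.
  by apply/seteqP; split => z //; rewrite /xsection /= inE /C /= (negbTE ys) => -[].
have h u : P [set w | Y w <= s /\ s + u < Y w + Z w] = P [set w | C u (Y w, Z w)] by [].
have -> : [set w | Y w <= s /\ s < Y w + Z w] = [set w | Y w <= s /\ s + 0 < Y w + Z w].
  by rewrite addr0.
rewrite !h !independent_pair_law // -ge0_integralZl //; last first.
  exact: (measurable_fun_xsection (distribution P Z) (mC 0)).
apply: eq_integral => y _; rewrite !sec // addr0; case: ifP => _; last by rewrite mule0.
rewrite -EFinM -expRD; congr (expR _)%:E; ring.
Qed.

End TwoVariables.
End Memoryless.

(** * A single edge *)

Section EventsClosure.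
Context (R : realType) (d : measure_display) (Om : measurableType d)
  (P : probability Om R) (I : choiceType) (X : I -> {RV P >-> R}).
Implicit Types (Q : pred I) (F G : set Om).

Let GT Q := g_sigma_algebraType (cylinders X Q).

Lemma events_ofI Q F G : events_of X Q F -> events_of X Q G -> events_of X Q (F `&` G).
Proof. exact: (@measurableI _ (GT Q)). Qed.

Lemma events_ofC Q F : events_of X Q F -> events_of X Q (~` F).
Proof. exact: (@measurableC _ (GT Q)). Qed.

Lemma events_ofT Q : events_of X Q setT.
Proof. exact: (@measurableT _ (GT Q)). Qed.

Lemma events_of0 Q : events_of X Q set0.
Proof. exact: (@measurable0 _ (GT Q)). Qed.

Lemma events_ofU Q F G : events_of X Q F -> events_of X Q G -> events_of X Q (F `|` G).
Proof. exact: (@measurableU _ (GT Q)). Qed.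

Lemma events_of_bigcup Q (F : nat -> set Om) :
  (forall k, events_of X Q (F k)) -> events_of X Q (\bigcup_k F k).
Proof. by move=> h; exact: (@bigcupT_measurable _ (GT Q)). Qed.

Lemma events_of_sum Q (s : seq I) (A : set R) : all Q s -> measurable A ->
  events_of X Q ((fun w => \sum_(i <- s) X i w) @^-1` A).
Proof.
move=> qs mA.
have mX i : Q i -> @measurable_fun _ _ (GT Q) R setT (X i : Om -> R).
  move=> Qi _ B mB; rewrite setTI; apply: cylinders_events.
  exists [:: i], (fun=> B); split => //=; first by rewrite Qi.
  apply/seteqP; split => [w Bw j /=|w h]; first by rewrite inE => /eqP ->.
  by apply: (h i); rewrite /= inE.
pose Y (i : I) : Om -> R := if Q i then (X i : Om -> R) else (fun=> 0).
have mY i : @measurable_fun _ _ (GT Q) R setT (Y i).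
  by rewrite /Y; case: ifP => // Qi; exact: mX.
have -> : (fun w => \sum_(i <- s) X i w) = (fun w => \sum_(i <- s) Y i w).
  apply/funext => w; apply: eq_big_seq => i /(allP qs) Qi.
  by rewrite /Y Qi.
by have := @measurable_sum _ (GT Q) R setT I s Y mY measurableT A mA; rewrite setTI.
Qed.

End EventsClosure.

Section OnOff.
Context (R : realType) (d : measure_display) (Om : measurableType d)
  (P : probability Om R) (h : nat -> {RV P >-> R}) (a b : R).
Hypotheses (a0 : 0 < a) (b0 : 0 < b) (indh : mutually_independent h).
Hypothesis lawh : forall k, has_exponential_law (if odd k then a else b) (h k).

(** What is known when the [m]-th period begins. *)
Definition past m : set (set Om) := events_of h (fun k => (k < m)%N).

Definition jump m (w : Om) : R := \sum_(k < m) h k w.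

(** The [m]-th period is the current one at time [s]. *)
Definition stage m s : set Om := [set w | jump m w <= s < jump m.+1 w].

(** The event [present] for a single pair. *)
Definition on t : set Om :=
  [set w | exists k : nat, jump k.*2.+1 w <= t < jump k.*2.+2 w].

(** An event of probability one; outside of it the jump times may fail to be
    increasing, because the laws only give that the durations are nonnegative
    almost surely. *)
Definition regular : set Om := [set w | forall k, 0 <= h k w].

Lemma jumpS m w : jump m.+1 w = jump m w + h m w.
Proof. by rewrite /jump big_ord_recr. Qed.

Lemma jump_past k m A : (k <= m)%N -> measurable A -> past m (jump k @^-1` A).
Proof.
move=> km mA.
have -> : jump k = (fun w => \sum_(i <- iota 0 k) h i w).
  by apply/funext => w; rewrite /jump -(big_mkord predT (fun i => h i w)) /index_iota subn0.
apply: events_of_sum => //; apply/allP => i; rewrite mem_iota add0n => /andP[_ ik].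
exact: leq_trans km.
Qed.

Lemma jump_le_past k m s : (k <= m)%N -> past m [set w | jump k w <= s].
Proof.
move=> km; have := jump_past km (measurable_itv `]-oo, s]).
by congr (past _ _); apply/seteqP; split => w /=; rewrite in_itv.
Qed.

Lemma jump_gt_past k m s : (k <= m)%N -> past m [set w | s < jump k w].
Proof.
move=> km; have := jump_past km (measurable_itv `]s, +oo[).
by congr (past _ _); apply/seteqP; split => w /=; rewrite in_itv /= andbT.
Qed.

Lemma past_measurable m F : past m F -> measurable F.
Proof. exact: events_of_measurable. Qed.

Lemma past_sub m m' F : (m <= m')%N -> past m F -> past m' F.
Proof. by move=> mm; apply: events_of_sub => k /leq_trans; apply. Qed.

(** Lack of memory at the fixed time [s], conditionally on the past of the
    current period.  The past event [G] is encoded in one real variable, equal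
    to the jump time on the event of interest and to [s + 1] elsewhere, so that
    [memoryless_pair] applies. *)
Lemma memoryless_stage m G s t : past m G -> 0 <= t ->
  P (G `&` [set w | jump m w <= s] `&` [set w | s + t < jump m.+1 w]) =
  ((expR (- (if odd m then a else b) * t))%:E * P (G `&` stage m s))%E.
Proof.
move=> pG t0; set la := if odd m then a else b.
have la0 : 0 < la by rewrite /la; case: ifP.
pose G' := G `&` [set w | jump m w <= s].
have pG' : past m G' by apply: events_ofI => //; exact: jump_le_past.
pose Yf w : R := if `[< G' w >] then jump m w else s + 1.
have pY A : measurable A -> past m (Yf @^-1` A).
  move=> mA.
  have -> : Yf @^-1` A = (G' `&` jump m @^-1` A) `|` (~` G' `&` [set w | A (s + 1)]).
    apply/seteqP; split => w; rewrite /= /Yf; case: asboolP => Gw Aw; [left|right| |] => //.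
    - by case: Aw => -[].
    - by case: Aw => -[].
  apply: events_ofU; first by apply: events_ofI => //; exact: jump_past.
  apply: events_ofI; first exact: events_ofC.
  have [As|As] := pselect (A (s + 1)).
    by rewrite (_ : [set _ | _] = setT); [exact: events_ofT|apply/seteqP; split].
  by rewrite (_ : [set _ | _] = set0); [exact: events_of0|apply/seteqP; split].
have mY : measurable_fun setT Yf.
  by move=> _ A mA; rewrite setTI; apply: past_measurable (pY A mA).
pose Y : {mfun Om >-> R} := HB.pack Yf (isMeasurableFun.Build _ _ _ _ Yf mY).
have indY A B : measurable A -> measurable B ->
    P (Y @^-1` A `&` h m @^-1` B) = (P (Y @^-1` A) * P (h m @^-1` B))%E.
  move=> mA mB; apply: (events_indep indh (Q := fun k => (k < m)%N) (Q' := pred1 m)).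
  - by move=> i im /=; rewrite neq_ltn im.
  - exact: pY.
  have -> : h m @^-1` B = (fun w => \sum_(i <- [:: m]) h i w) @^-1` B.
    by apply/seteqP; split => w; rewrite /= big_seq1.
  by apply: events_of_sum => //=; rewrite eqxx.
have key u : 0 <= u -> G `&` [set w | jump m w <= s] `&` [set w | s + u < jump m.+1 w] =
    [set w | Y w <= s /\ s + u < Y w + h m w].
  move=> u0; apply/seteqP; split => w.
    move=> [Gw] /=; rewrite jumpS /Yf => lt.
    by case: asboolP => // _; split => //; case: Gw.
  by rewrite /= /Yf; case: asboolP => [Gw [_ lt]|_ [h1 _]]; [rewrite jumpS|lra].
rewrite key // (memoryless_pair indY s la0 (lawh m) t0).
congr (_ * P _)%E.
have := key 0 (lexx _); rewrite addr0 => <-.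
apply/seteqP; split => w; rewrite /stage /=.
  by move=> [[Gw h1] h2]; rewrite h1 h2.
by move=> [Gw /andP[h1 h2]].
Qed.

Lemma jump_ge0 w m : regular w -> 0 <= jump m w.
Proof. by move=> rw; apply: sumr_ge0 => k _; exact: rw. Qed.

Lemma jump_mono w m m' : regular w -> (m <= m')%N -> jump m w <= jump m' w.
Proof.
move=> rw /subnKC <-; elim: (m' - m)%N => [|k IH]; first by rewrite addn0.
by rewrite addnS jumpS; apply: le_trans IH _; rewrite lerDl.
Qed.

Lemma regular_measurable : measurable regular.
Proof.
have -> : regular = \bigcap_k (h k @^-1` `[0, +oo[).
  apply/seteqP; split => [w rw k _ /=|w rw k]; first by rewrite in_itv /= andbT.
  by have := rw k I; rewrite /= in_itv /= andbT.
apply: bigcapT_measurable => k.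
by rewrite -[X in measurable X]setTI; exact: measurable_funPT.
Qed.

Lemma regularC_null : P (~` regular) = 0%E.
Proof.
have -> : ~` regular = \bigcup_k [set w | h k w < 0].
  apply/seteqP; split => [w /= /existsNP[k /negP]|w [k _ /= hk] /(_ k)].
    by rewrite -ltNge => hk; exists k.
  by rewrite leNgt hk.
have hm k : measurable [set w | h k w < 0].
  have -> : [set w | h k w < 0] = h k @^-1` `]-oo, 0[.
    by apply/seteqP; split => w /=; rewrite in_itv.
  by rewrite -[X in measurable X]setTI; exact: measurable_funPT.
apply/negligibleP; first exact: bigcupT_measurable.
apply: negligible_bigcup => k; apply/negligibleP => //.
by apply: exponential_ge0 (lawh k); case: ifP.
Qed.

Lemma regular_full F : measurable F -> P (F `&` regular) = P F.
Proof.
move=> mF; rewrite [RHS](measureDI _ mF regular_measurable).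
rewrite [X in (X + _)%E](_ : _ = 0%E) ?add0e //.
apply/eqP; rewrite -measure_le0 -regularC_null setDE; apply: measureIr => //.
exact/measurableC/regular_measurable.
Qed.

(** A Riemann sum for the probability that an absent edge appears before time
    [T] and survives until [T].  The finite number [N] of slices costs only
    the factor [expR (- a * (T / N))], so no limit is taken. *)
Lemma slice_sum_ge (T : R) N : 0 <= T -> (0 < N)%N ->
  expR (- b * T) * (b / a) * expR (- a * (T / N%:R)) * (1 - expR (- a * T)) <=
  \sum_(i < N) (expR (- b * (i%:R * (T / N%:R))) - expR (- b * (i.+1%:R * (T / N%:R))))
     * expR (- a * (T - i%:R * (T / N%:R))).
Proof.
move=> T0 N0; set D := T / N%:R.
have NR : (0 : R) < N%:R by rewrite ltr0n.
have D0 : 0 <= D by rewrite divr_ge0 // ltW.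
have ND : N%:R * D = T by rewrite /D mulrCA divff ?mulr1 // gt_eqF.
have step i : (i < N)%N ->
   (expR (- b * T) * (b * D)) * (expR (- a * T) * expR (a * D) ^+ i) <=
   (expR (- b * (i%:R * D)) - expR (- b * (i.+1%:R * D))) * expR (- a * (T - i%:R * D)).
  move=> iN.
  have -> : expR (- a * (T - i%:R * D)) = expR (- a * T) * expR (a * D) ^+ i.
    by rewrite -expRM_natl -expRD; congr expR; ring.
  apply: ler_wpM2r; first by rewrite mulr_ge0 ?exprn_ge0 ?expR_ge0.
  have -> : expR (- b * (i%:R * D)) = expR (- b * (i.+1%:R * D)) * expR (b * D).
    by rewrite -expRD; congr expR; rewrite -natr1; ring.
  have le1 : expR (- b * T) <= expR (- b * (i.+1%:R * D)).
    rewrite ler_expR; apply: ler_wnM2l; first by rewrite oppr_le0 ltW.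
    by rewrite -ND; apply: ler_wpM2r => //; rewrite ler_nat.
  have le2 := expR_ge1Dx (b * D).
  have bD : 0 <= b * D by rewrite mulr_ge0 // ltW.
  rewrite -[X in _ <= _ - X]mulr1 -mulrBr; apply: ler_pM => //; rewrite ?expR_ge0 //.
  by rewrite lerBrDl.
apply: (@le_trans _ _ (\sum_(i < N)
    (expR (- b * T) * (b * D)) * (expR (- a * T) * expR (a * D) ^+ i))); last first.
  by apply: ler_sum => i _; exact: step.
rewrite -mulr_sumr -mulr_sumr.
set E := expR (a * D).
have EN : E ^+ N = expR (a * T) by rewrite -expRM_natl mulrCA ND.
have geom : (E - 1) * \sum_(i < N) E ^+ i = expR (a * T) - 1 by rewrite -subrX1 EN.
have aT : expR (- a * T) * expR (a * T) = 1 by rewrite -expRD mulNr addNr expR0.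
have aD : expR (- a * D) * E = 1 by rewrite -expRD mulNr addNr expR0.
have S0 : 0 <= \sum_(i < N) E ^+ i by apply: sumr_ge0 => i _; rewrite exprn_ge0 ?expR_ge0.
set S := \sum_(i < N) _ in geom S0 *.
have e1 : 1 - expR (- a * D) <= a * D.
  by have := expR_ge1Dx (- a * D); lra.
have key : expR (- a * D) * (1 - expR (- a * T)) <= a * D * (expR (- a * T) * S).
  have -> : expR (- a * D) * (1 - expR (- a * T)) =
            (1 - expR (- a * D)) * (expR (- a * T) * S).
    transitivity (expR (- a * D) * expR (- a * T) * (expR (a * T) - 1)).
      by rewrite -[RHS]mulrA [X in _ = _ * X]mulrBr mulr1 aT.
    have <- : expR (- a * D) * (E - 1) = 1 - expR (- a * D) by rewrite mulrBr mulr1 aD.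
    by rewrite -geom; ring.
  by apply: ler_wpM2r => //; rewrite mulr_ge0 ?expR_ge0.
have ba : 0 <= expR (- b * T) * (b / a) by rewrite mulr_ge0 ?expR_ge0 // divr_ge0 // ltW.
rewrite -[leLHS]mulrA; apply: le_trans (ler_wpM2l ba key) _.
have -> : expR (- b * T) * (b / a) * (a * D * (expR (- a * T) * S)) =
  expR (- b * T) * (b * D) * (expR (- a * T) * S) * (a / a) by ring.
by rewrite divff ?mulr1 ?gt_eqF.
Qed.

Lemma exp_slice m G s r r' : ~~ odd m -> past m G -> 0 <= r <= r' ->
  P (G `&` [set w | jump m w <= s] `&` [set w | s + r < jump m.+1 w <= s + r']) =
  ((expR (- b * r) - expR (- b * r'))%:E * P (G `&` stage m s))%E.
Proof.
move=> om pG /andP[r0 rr']; have r'0 := le_trans r0 rr'.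
set G' := G `&` _.
have pG' : past m G' by apply: events_ofI => //; exact: jump_le_past.
have mlt u : measurable [set w | u < jump m.+1 w].
  by apply: (@past_measurable m.+1); exact: jump_gt_past.
set A := G' `&` [set w | s + r < jump m.+1 w].
set B := G' `&` [set w | s + r' < jump m.+1 w].
have mG' := past_measurable pG'.
have mA : measurable A by exact: measurableI.
have mB : measurable B by exact: measurableI.
have AB : A `&` B = B.
  by apply/seteqP; split => w; [case|move=> [Gw /= lt]; split => //; split => //=; lra].
have -> : G' `&` [set w | s + r < jump m.+1 w <= s + r'] = A `\` B.
  apply/seteqP; split => w.
    by move=> [Gw /= /andP[h1 h2]]; split => //= -[_ /=]; rewrite ltNge h2.
  move=> [[Gw /= h1] /not_andP[//|/= /negP]]; rewrite -leNgt => h2.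
  by split => //=; rewrite h1 h2.
have fin F : measurable F -> exists2 x : R, P F = x%:E & 0 <= x.
  move=> mF; exists (fine (P F)); last exact: fine_ge0.
  by rewrite fineK // fin_num_measure.
have Ale : (P A < +oo)%E by apply: le_lt_trans (probability_le1 P mA) (ltry 1).
apply: etrans (measureD mA mB Ale) _.
have mst : measurable (G `&` stage m s).
  have -> : G `&` stage m s = G' `&` [set w | s < jump m.+1 w].
    apply/seteqP; split => w; first by move=> [Gw /andP[h1 h2]].
    by move=> [[Gw h1] h2]; split => //; rewrite /stage /= h1.
  exact: measurableI.
have [x Px x0] := fin _ mst.
have EA := memoryless_stage s pG r0; have EB := memoryless_stage s pG r'0.
rewrite (negbTE om) Px -EFinM in EA EB.
apply: etrans (congr2 (fun u v => (u - v)%E) EA _) _.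
  by rewrite AB; exact: EB.
by rewrite -EFinB Px -EFinM mulrBl.
Qed.


Lemma stage_measurable m s : measurable (stage m s).
Proof.
have -> : stage m s = [set w | jump m w <= s] `&` [set w | s < jump m.+1 w].
  by apply/seteqP; split => w; rewrite /stage /=; [move=> /andP[]|move=> [-> ->]].
apply: measurableI; first exact: past_measurable (jump_le_past s (leqnn m)).
exact: past_measurable (jump_gt_past s (leqnn m.+1)).
Qed.

Lemma on_measurable t : measurable (on t).
Proof.
have -> : on t = \bigcup_k ([set w | jump k.*2.+1 w <= t] `&` [set w | t < jump k.*2.+2 w]).
  apply/seteqP; split => w; rewrite /on /=.
    by move=> [k /andP[h1 h2]]; exists k.
  by move=> [k _ [h1 h2]]; exists k; rewrite h1 h2.
apply: bigcupT_measurable => k; apply: measurableI.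
  exact: past_measurable (jump_le_past t (leqnn _)).
exact: past_measurable (jump_gt_past t (leqnn _)).
Qed.

(** A present edge may simply survive. *)
Lemma on_stage_ge_odd m G s T q : odd m -> past m G -> 0 <= T ->
  q <= expR (- a * T) ->
  (q%:E * P (G `&` stage m s) <= P (G `&` stage m s `&` on (s + T)%R))%E.
Proof.
move=> om pG T0 qa; have mG := past_measurable pG.
apply: (@le_trans _ _ ((expR (- a * T))%:E * P (G `&` stage m s))%E).
  by apply: lee_wpmul2r => //; rewrite lee_fin.
have := memoryless_stage s pG T0; rewrite om => <-.
apply: le_measure; rewrite ?inE.
- apply: measurableI.
    by apply: measurableI => //; exact: past_measurable (jump_le_past s (leqnn m)).
  exact: past_measurable (jump_gt_past (s + T) (leqnn m.+1)).
- apply: measurableI; last exact: on_measurable.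
  by apply: measurableI => //; exact: stage_measurable.
move=> w [[Gw /= h1] h2]; split; first by split => //; rewrite /stage /= h1 /=; lra.
exists m./2; have -> : m./2.*2.+1 = m.
  by rewrite -[RHS]odd_double_half om add1n.
by rewrite h2 andbT; lra.
Qed.

(** An absent edge may appear within [T] and then survive.  The time of
    appearance is localized in one of [N] slices; in each slice the survival
    is asked from the beginning of the slice, which makes it independent of
    the exact time of appearance. *)
Lemma on_stage_ge_even m G s T N q : ~~ odd m -> past m G -> 0 <= T -> (0 < N)%N ->
  q <= expR (- b * T) * (b / a) * expR (- a * (T / N%:R)) * (1 - expR (- a * T)) ->
  (q%:E * P (G `&` stage m s) <= P (G `&` stage m s `&` on (s + T)%R))%E.
Proof.
move=> om pG T0 N0 qle; have mG := past_measurable pG.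
have mst : measurable (G `&` stage m s) by apply: measurableI => //; exact: stage_measurable.
have [x Px x0] : exists2 x : R, P (G `&` stage m s) = x%:E & 0 <= x.
  exists (fine (P (G `&` stage m s))); last exact: fine_ge0.
  by rewrite fineK // fin_num_measure.
set D := T / N%:R in qle.
have NR : (0 : R) < N%:R by rewrite ltr0n.
have D0 : 0 <= D by rewrite divr_ge0 // ltW.
have ND : N%:R * D = T by rewrite /D mulrCA divff ?mulr1 // gt_eqF.
pose A i := G `&` [set w | jump m w <= s] `&`
  [set w | s + i%:R * D < jump m.+1 w <= s + i.+1%:R * D].
pose B i := [set w | T - i%:R * D < h m.+1 w].
pose U (i : 'I_N) := A i `&` B i.
have iD i : 0 <= i%:R * D <= i.+1%:R * D.
  by rewrite mulr_ge0 //= ler_wpM2r // ler_nat.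
have pA i : past m.+1 (A i).
  apply: events_ofI.
    by apply: (@past_sub m) => //; apply: events_ofI => //; exact: jump_le_past.
  have -> : [set w | s + i%:R * D < jump m.+1 w <= s + i.+1%:R * D] =
     [set w | s + i%:R * D < jump m.+1 w] `&` [set w | jump m.+1 w <= s + i.+1%:R * D].
    by apply/seteqP; split => w /=; [move=> /andP[]|move=> [-> ->]].
  by apply: events_ofI; [exact: jump_gt_past|exact: jump_le_past].
have eB i : events_of h (pred1 m.+1) (B i).
  have -> : B i = (fun w => \sum_(j <- [:: m.+1]) h j w) @^-1` `]T - i%:R * D, +oo[.
    by apply/seteqP; split => w; rewrite /= big_seq1 in_itv /= andbT.
  by apply: events_of_sum => //=; rewrite eqxx.
have PB i : (i <= N)%N -> P (B i) = (expR (- a * (T - i%:R * D)))%:E.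
  move=> iN; have := lawh m.+1; rewrite /= om => law.
  have TD : 0 <= T - i%:R * D.
    by rewrite subr_ge0 -[leRHS]ND ler_wpM2r // ler_nat.
  rewrite -(exponential_tail a0 law TD); congr (P _).
  by apply/seteqP; split => w; rewrite /B /= in_itv /= andbT.
have PU i : P (U i) = (((expR (- b * (i%:R * D)) - expR (- b * (i.+1%:R * D)))
     * expR (- a * (T - i%:R * D))) * x)%:E.
  apply: etrans (events_indep indh _ (pA i) (eB i)) _.
    by move=> j jm /=; rewrite neq_ltn jm.
  rewrite (exp_slice s om pG (iD i)) Px (PB i (ltnW (ltn_ord i))) -!EFinM.
  by congr (_%:E); ring.
have mU i : measurable (U i).
  apply: measurableI; first exact: past_measurable (pA i).
  exact: events_of_measurable (eB i).
have tU : trivIset setT U.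
  apply/trivIsetP => i j _ _ ij; wlog ltij : i j ij / (i < j)%N.
    move=> H; case: (ltngtP i j) => [|ji|/val_inj E]; first exact: H.
      by rewrite setIC; apply: H => //; rewrite eq_sym.
    by rewrite E eqxx in ij.
  apply/seteqP; split => w //= -[[[_ /= /andP[_ h1]] _] [[_ /= /andP[h2 _]] _]].
  have : i.+1%:R * D <= j%:R * D by rewrite ler_wpM2r // ler_nat.
  lra.
have mbU : measurable (\big[setU/set0]_(i < N) U i) by exact: bigsetU_measurable.
apply: (@le_trans _ _ (P (\big[setU/set0]_(i < N) U i))).
  apply: le_trans (_ : _ <= \sum_(i < N) P (U i))%E _; last first.
    by rewrite le_eqVlt; apply/orP; left; apply/eqP; apply/esym; exact: measure_bigsetU_ord.
  rewrite (eq_bigr _ (fun i _ => PU i)) sumEFin -mulr_suml Px -EFinM lee_fin.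
  apply: ler_wpM2r => //; apply: le_trans qle _; exact: slice_sum_ge.
apply: le_measure; rewrite ?inE //.
  by apply: measurableI => //; exact: on_measurable.
rewrite -bigcup_seq => w [i _ [[[Gw /= h1] /andP[h2 h3]]]]; rewrite /B /= => h4.
have iD0 := iD i; case/andP: iD0 => i0 i1.
have iN : i.+1%:R * D <= T by rewrite -[leRHS]ND ler_wpM2r // ler_nat.
split; first by split => //; rewrite /stage /= h1 /=; lra.
exists m./2; have -> : m./2.*2 = m by rewrite -[RHS]odd_double_half (negbTE om).
by rewrite [jump m.+2 w]jumpS; apply/andP; split; lra.
Qed.

(** The events decided by the evolution up to time [s]: on each stage they
    agree with an event of the past of that stage, up to irregular
    trajectories. *)
Definition adapted s (F : set Om) : Prop :=
  measurable F /\ forall m, exists2 G, past m G &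
    F `&` stage m s `&` regular = G `&` stage m s `&` regular.

Lemma adapted_on t s : t <= s -> adapted s (on t).
Proof.
move=> ts; split; first exact: on_measurable.
move=> m.
(* only the jumps up to the [m]-th are looked at: on stage [m], the next one
   occurs after [s], hence after [t] *)
exists (\bigcup_k (if (k.*2.+1 <= m)%N then
   [set w | jump k.*2.+1 w <= t] `&`
     (if (k.*2.+2 <= m)%N then [set w | t < jump k.*2.+2 w] else setT)
   else set0)).
  apply: events_of_bigcup => k; case: ifPn => km; last exact: events_of0.
  apply: events_ofI; first exact: jump_le_past.
  by case: ifPn => km'; [exact: jump_gt_past|exact: events_ofT].
apply/seteqP; split => w [[onw /andP[sm smS]] rw]; split => //; split => //; rewrite ?/stage /= ?sm //.
  move: onw => [k /andP[h1 h2]]; exists k => //.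
  have km : (k.*2.+1 <= m)%N.
    rewrite leqNgt; apply/negP => mk.
    by have := jump_mono rw mk; lra.
  by rewrite km; split => //; case: ifP.
move: onw => [k _]; case: ifPn => // km [/= h1 h2].
exists k; rewrite h1 /=; move: h2; case: ifPn => [_ //|].
rewrite -ltnNge ltnS => mk _; have -> : k.*2.+1 = m by apply/eqP; rewrite eqn_leq km.
exact: le_lt_trans smS.
Qed.

Lemma adaptedC s F : adapted s F -> adapted s (~` F).
Proof.
move=> [mF aF]; split; first exact: measurableC.
move=> m; have [G pG E] := aF m; exists (~` G); first exact: events_ofC.
apply/seteqP; split => w [[Fw sw] rw]; split => //; split => // H.
  have [[//]] : (F `&` stage m s `&` regular) w by rewrite E.
have [[//]] : (G `&` stage m s `&` regular) w by rewrite -E.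
Qed.

Lemma adaptedI s F F' : adapted s F -> adapted s F' -> adapted s (F `&` F').
Proof.
move=> [mF aF] [mF' aF']; split; first exact: measurableI.
move=> m; have [G pG E] := aF m; have [G' pG' E'] := aF' m.
exists (G `&` G'); first exact: events_ofI.
have reorg A A' : A `&` A' `&` stage m s `&` regular =
   (A `&` stage m s `&` regular) `&` (A' `&` stage m s `&` regular).
  by apply/seteqP; split => w; rewrite /setI /=; tauto.
by rewrite !reorg E E'.
Qed.

Lemma adaptedT s : adapted s setT.
Proof. by split => // m; exists setT => //; exact: events_ofT. Qed.


Lemma hold_le_prob k s : 0 <= s ->
  (P (h k @^-1` `]-oo, s]) <= (1 - expR (- (a + b) * s))%:E)%E.
Proof.
move=> s0.
have la0 : 0 < (if odd k then a else b) by case: ifP.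
have m1 : measurable (h k @^-1` `]s, +oo[).
  by rewrite -[X in measurable X]setTI; exact: measurable_funPT.
have -> : h k @^-1` `]-oo, s] = ~` (h k @^-1` `]s, +oo[).
  by rewrite preimage_setC setCitvr.
rewrite probability_setC //.
apply: le_trans (_ : _ <= 1 - (expR (- (if odd k then a else b) * s))%:E)%E _.
  by rewrite -(exponential_tail la0 (lawh k) s0).
rewrite -EFinB lee_fin lerB // ler_expR.
apply: ler_wpM2r => //; rewrite lerN2.
by case: ifP => _; rewrite ?lerDl ?lerDr ltW.
Qed.

(** Infinitely many jumps before [s] would require all durations to be at most
    [s], and these are independent events with probabilities bounded away from
    one. *)
Lemma never_null s : 0 <= s ->
  P ([set w | forall m, jump m w <= s] `&` regular) = 0%E.
Proof.
move=> s0; set N := _ `&` _.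
have mN : measurable N.
  apply: measurableI; last exact: regular_measurable.
  have -> : [set w | forall m, jump m w <= s] = \bigcap_m [set w | jump m w <= s].
    by apply/seteqP; split => w /= H m; [move=> _|]; apply: H.
  by apply: bigcapT_measurable => m; exact: past_measurable (jump_le_past s (leqnn m)).
(* both rates are at most [a + b] *)
set c := 1 - expR (- (a + b) * s).
have c0 : 0 <= c.
  by rewrite subr_ge0 expR_le1 mulNr oppr_le0 mulr_ge0 // addr_ge0 // ltW.
have c1 : c < 1 by rewrite gtrBl expR_gt0.
have le M : (P N <= (c ^+ M)%:E)%E.
  apply: (@le_trans _ _ (P (\bigcap_(k in [set` iota 0 M]) (h k @^-1` `]-oo, s])))).
    apply: le_measure; rewrite ?inE //.
      apply: fin_bigcap_measurable => // k _.
      by rewrite -[X in measurable X]setTI; exact: measurable_funPT.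
    move=> w [jw rw] k _ /=; rewrite in_itv /=.
    by have := jw k.+1; rewrite jumpS; have := jump_ge0 k rw; lra.
  rewrite (indh (A := fun=> `]-oo, s]%classic)) ?iota_uniq //.
  rewrite (_ : c ^+ M = \prod_(k <- iota 0 M) c); last first.
    by rewrite big_const_seq count_predT size_iota iter_mulr_1.
  elim: (iota 0 M) => [|k l IH]; first by rewrite !big_nil.
  rewrite !big_cons EFinM; apply: lee_pmul => //.
    by apply: prode_ge0.
  exact: hold_le_prob.
have [x Px x0] : exists2 x : R, P N = x%:E & 0 <= x.
  by exists (fine (P N)); [rewrite fineK // fin_num_measure|exact: fine_ge0].
rewrite Px in le *; congr (_%:E); apply/eqP; rewrite eq_le x0 andbT leNgt; apply/negP => xp.
have cc : `|c| < 1 by rewrite ger0_norm.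
have [M _ /(_ M (leqnn M))] := cvgr_lt _ (cvg_expr cc) _ xp.
by rewrite ltNge -lee_fin le.
Qed.

(** The event is cut according to the stage at time [s].  The bound holds on
    each stage ([on_stage_ge_odd], [on_stage_ge_even]), and the stages cover
    almost everything ([never_null]). *)
Lemma on_step F s T N q : adapted s F -> 0 <= s -> 0 <= T -> (0 < N)%N -> 0 <= q ->
  q <= expR (- a * T) ->
  q <= expR (- b * T) * (b / a) * expR (- a * (T / N%:R)) * (1 - expR (- a * T)) ->
  (q%:E * P F <= P (F `&` on (s + T)%R))%E.
Proof.
move=> [mF aF] s0 T0 N0 q0 qa qb.
pose A m := F `&` stage m s `&` regular.
have mst m := stage_measurable m s; have mreg := regular_measurable.
have mA m : measurable (A m) by apply: measurableI => //; exact: measurableI.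
have mon := on_measurable (s + T).
have tA : trivIset setT A.
  apply/trivIsetP => i j _ _ ij; wlog ltij : i j ij / (i < j)%N.
    move=> H; case: (ltngtP i j) => [|ji|E]; first exact: H.
      by rewrite setIC; apply: H => //; rewrite eq_sym.
    by rewrite E eqxx in ij.
  apply/seteqP; split => w //= -[[[_ /= /andP[_ h1]] rw] [[_ /= /andP[h2 _]] _]].
  by have := jump_mono rw ltij; lra.
have stepA m : (q%:E * P (A m) <= P (A m `&` on (s + T)%R))%E.
  have [G pG E] := aF m.
  have mG := past_measurable pG.
  have -> : A m `&` on (s + T) = (G `&` stage m s `&` on (s + T)) `&` regular.
    by rewrite /A E -!setIA [regular `&` _]setIC.
  have mGs : measurable (G `&` stage m s) by exact: measurableI.
  rewrite {1}/A E (regular_full mGs) (regular_full (measurableI _ _ mGs mon)).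
  have [om|om] := boolP (odd m); first exact: on_stage_ge_odd.
  exact: on_stage_ge_even N0 qb.
(* a regular trajectory outside of all stages has all its jumps before [s] *)
pose NN := [set w | forall m, jump m w <= s] `&` regular.
have cover : F `&` regular `<=` \bigcup_m A m `|` NN.
  move=> w [Fw rw]; have [all|] := pselect (forall m, jump m w <= s); first by right.
  move=> /existsNP[m /negP]; rewrite -ltNge => sm; left.
  have ex : exists m, s < jump m w by exists m.
  have [m0 sm0 min] := ex_minnP ex.
  case: m0 sm0 min => [|k] sk min.
    by move: sk; rewrite /jump big_ord0; lra.
  exists k => //; split => //; split => //; rewrite /stage /= sk andbT leNgt.
  by apply/negP => /min; rewrite ltnn.
have mUA : measurable (\bigcup_m A m) by exact: bigcupT_measurable.
have mNN : measurable NN.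
  apply: measurableI => //.
  have -> : [set w | forall m, jump m w <= s] = \bigcap_m [set w | jump m w <= s].
    by apply/seteqP; split => w /= H m; [move=> _|]; apply: H.
  by apply: bigcapT_measurable => m; exact: past_measurable (jump_le_past s (leqnn m)).
have PF : (P F <= P (\bigcup_m A m))%E.
  rewrite -(regular_full mF).
  apply: (@le_trans _ _ (P (\bigcup_m A m `|` NN))).
    by apply: le_measure; rewrite ?inE //; [exact: measurableI|exact: measurableU].
  have := measureU0 mUA mNN (never_null s0) => E.
  by rewrite le_eqVlt; apply/orP; left; apply/eqP.
apply: le_trans (lee_wpmul2l _ PF) _; first by rewrite lee_fin.
rewrite measure_semi_bigcup // -nneseriesZl //.
apply: (@le_trans _ _ (\sum_(i <oo) P (A i `&` on (s + T)%R))%E).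
  by apply: lee_nneseries => [i _ _|i _]; [rewrite mule_ge0|exact: stepA].
rewrite -measure_semi_bigcup //.
- apply: le_measure; rewrite ?inE //.
  + by apply: bigcupT_measurable => m; exact: measurableI.
  + exact: measurableI.
  by move=> w [m _ [[[Fw _] _] onw]].
- by move=> m; exact: measurableI.
- apply/trivIsetP => i j _ _ ij; move/trivIsetP : tA => /(_ i j I I ij) E.
  apply/seteqP; split => w //= -[[Ai _] [Aj _]].
  by have : (A i `&` A j) w by []; rewrite E.
by apply: bigcupT_measurable => m; exact: measurableI.
Qed.

End OnOff.

(** * Trials for the whole graph *)

Lemma measure_bigsetU_le (R : realType) (d : measure_display) (Om : measurableType d)
    (P : probability Om R) (I : Type) (r : seq I) (Q : pred I) (F : I -> set Om) :
  (forall i, measurable (F i)) ->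
  (P (\big[setU/set0]_(i <- r | Q i) F i) <= \sum_(i <- r | Q i) P (F i))%E.
Proof.
move=> mF; elim: r => [|i r IHr]; first by rewrite !big_nil measure0.
rewrite !big_cons; case: ifP => // _.
have mr : measurable (\big[setU/set0]_(j <- r | Q j) F j) by exact: bigsetU_measurable.
apply: (@le_trans _ _ (P (F i) + P (\big[setU/set0]_(j <- r | Q j) F j))%E).
  exact: measureU2.
exact: leeD2l.
Qed.

Section Trials.
Context (R : realType) (alpha : R) (n : nat) (d : measure_display)
  (Om : measurableType d) (P : probability Om R)
  (hold : vpair n -> nat -> {RV P >-> R}).
Hypotheses (alpha0 : 0 < alpha) (n1 : (1 < n)%N).
Hypothesis dyn : is_dynamic_ER alpha alpha hold.
Variables (T q : R) (N : nat).
Hypotheses (T0 : 0 <= T) (N0 : (0 < N)%N) (q01 : 0 <= q <= 1).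
Let b := alpha / n.-1%:R.
Hypotheses (qa : q <= expR (- alpha * T))
  (qb : q <= expR (- b * T) * (b / alpha) * expR (- alpha * (T / N%:R)) * (1 - expR (- alpha * T))).

Let b0 : 0 < b.
Proof. by rewrite divr_gt0 // ltr0n; case: n n1 => [|[]]. Qed.

Let edge : finType := {e : {set 'I_n} | #|e| == 2%N}.

Implicit Types (e : edge) (S : {set edge}) (s : seq {set edge}).

Let ind_edge e : mutually_independent (hold e).
Proof.
move=> J A uJ mA.
have := hold_independent dyn (J := [seq (e, k) | k <- J]) (A := fun ek => A ek.2).
rewrite map_inj_uniq // => [/(_ uJ (fun _ => mA _))|x y [] //].
rewrite big_map /= => <-; congr (P _).
apply/seteqP; split => w H k /=.
  by move=> /mapP[j jJ ->] /=; exact: (H j).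
by move=> kJ; apply: (H (e, k)); apply/mapP; exists k.
Qed.

Let law_edge e k : has_exponential_law (if odd k then alpha else b) (hold e k).
Proof. exact: hold_exponential dyn e k. Qed.

Definition state t w : {set edge} :=
  [set e : edge | `[< present (fun e k => hold e k) w t e >]]%SET.

Definition edge_in e t (c : bool) : set Om :=
  if c then on (hold e) t else ~` on (hold e) t.

(** The list [s] prescribes the sets of edges present at the inspections
    already made, the latest first; only its trace on [e] matters here. *)
Fixpoint edge_history e s : set Om :=
  if s is A :: s' then edge_history e s' `&` edge_in e ((size s)%:R * T) (e \in A)
  else setT.

Lemma edge_history_adapted e s t : (size s)%:R * T <= t ->
  adapted (hold e) t (edge_history e s).
Proof.
elim: s => [|S s IHs] /= st; first exact: adaptedT.
apply: adaptedI.
  by apply: IHs; apply: le_trans st; rewrite ler_wpM2r // ler_nat.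
by rewrite /edge_in; case: ifP => _; [|apply: adaptedC]; exact: adapted_on.
Qed.

Lemma edge_history_measurable e s : measurable (edge_history e s).
Proof. by have [] := edge_history_adapted e (lexx ((size s)%:R * T)). Qed.

Lemma edge_in_events e t c :
  events_of (fun ek : edge * nat => hold ek.1 ek.2) (fun ek => ek.1 == e) (edge_in e t c).
Proof.
have jumpE m A : measurable A ->
    events_of (fun ek : edge * nat => hold ek.1 ek.2) (fun ek => ek.1 == e)
      (jump (hold e) m @^-1` A).
  move=> mA.
  have -> : jump (hold e) m = (fun w => \sum_(ek <- [seq (e, k) | k <- iota 0 m]) hold ek.1 ek.2 w).
    by apply/funext => w; rewrite big_map /jump -(big_mkord predT (fun k => hold e k w)) /index_iota subn0.
  by apply: events_of_sum => //; apply/allP => _ /mapP[k _ ->] /=.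
have onE : events_of (fun ek : edge * nat => hold ek.1 ek.2) (fun ek => ek.1 == e) (on (hold e) t).
  have -> : on (hold e) t = \bigcup_k ((jump (hold e) k.*2.+1 @^-1` `]-oo, t]) `&`
      (jump (hold e) k.*2.+2 @^-1` `]t, +oo[)).
    apply/seteqP; split => w; rewrite /on /=.
      by move=> [k /andP[h1 h2]]; exists k => //; rewrite /= !in_itv /= andbT.
    by move=> [k _]; rewrite /= !in_itv /= andbT => -[h1 h2]; exists k; rewrite h1 h2.
  by apply: events_of_bigcup => k; apply: events_ofI; exact: jumpE.
by rewrite /edge_in; case: c => //; exact: events_ofC.
Qed.

Definition history s : set Om := \bigcap_(e in [set` enum edge]) edge_history e s.

Lemma history_measurable s : measurable (history s).
Proof. by apply: fin_bigcap_measurable => // e _; exact: edge_history_measurable. Qed.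

(** Distinct edges use disjoint families of durations. *)
Lemma history_prod s : P (history s) = (\prod_(e <- enum edge) P (edge_history e s))%E.
Proof.
apply: (groups_indep (hold_independent dyn) (Q := fun e ek => ek.1 == e)).
- exact: enum_uniq.
- by move=> e e' ek _ _ /eqP <- /eqP <-.
move=> e _; elim: s => [|S s IHs] /=; first exact: events_ofT.
by apply: events_ofI => //; exact: edge_in_events.
Qed.

Let pe e s := fine (P (edge_history e s)).

Let peE e s : P (edge_history e s) = (pe e s)%:E.
Proof. by rewrite fineK // fin_num_measure //; exact: edge_history_measurable. Qed.

Let pa e s := fine (P (edge_history e s `&` edge_in e ((size s).+1%:R * T) true)).
Let pb e s := fine (P (edge_history e s `&` edge_in e ((size s).+1%:R * T) false)).

Lemma edge_in_measurable e t c : measurable (edge_in e t c).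
Proof. by rewrite /edge_in; case: c; [|apply: measurableC]; exact: on_measurable. Qed.

Let paE e s : P (edge_history e s `&` edge_in e ((size s).+1%:R * T) true) = (pa e s)%:E.
Proof.
rewrite fineK // fin_num_measure //; apply: measurableI; first exact: edge_history_measurable.
exact: edge_in_measurable.
Qed.

Let pbE e s : P (edge_history e s `&` edge_in e ((size s).+1%:R * T) false) = (pb e s)%:E.
Proof.
rewrite fineK // fin_num_measure //; apply: measurableI; first exact: edge_history_measurable.
exact: edge_in_measurable.
Qed.

Let pab e s : pa e s + pb e s = pe e s.
Proof.
apply: EFin_inj; rewrite EFinD -paE -pbE -peE addrC.
have := measureDI P (edge_history_measurable e s) (edge_in_measurable e ((size s).+1%:R * T) true).
by rewrite setDE => ->.
Qed.

Let qpa e s : q * pe e s <= pa e s.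
Proof.
rewrite -lee_fin EFinM -peE -paE.
have s0 : 0 <= (size s)%:R * T by rewrite mulr_ge0.
case/andP: q01 => q0 _.
have := on_step alpha0 b0 (ind_edge e) (law_edge e) (edge_history_adapted e (lexx _)) s0 T0 N0 q0 qa qb.
by rewrite /edge_in -natr1 mulrDl mul1r.
Qed.

(** Given the history, the edges are independent, and each is present at the
    next inspection with conditional probability at least [q]; hence the next
    state has an increasing property [U] with conditional probability at least
    [p]. *)
Lemma history_step (U : {set edge} -> bool) (p : R) s :
  (forall S S', S \subset S' -> U S -> U S') ->
  p <= bern q (enum edge) (fun S => (U S)%:R) ->
  (\sum_(S : {set edge} | ~~ U S) P (history (S :: s)) <= (1 - p)%:E * P (history s))%E.
Proof.
move=> Umono pU.
have hS S : P (history (S :: s)) =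
    (\prod_(e <- enum edge) (if e \in S then pa e s else pb e s))%:E.
  rewrite history_prod /= -prodEFin; apply: eq_bigr => e _.
  by case: ifP => eS; [exact: paE|exact: pbE].
have hs : P (history s) = (\prod_(e <- enum edge) pe e s)%:E.
  by rewrite history_prod -prodEFin; apply: eq_bigr => e _; exact: peE.
rewrite hs (eq_bigr _ (fun S _ => hS S)) sumEFin -EFinM lee_fin.
set c := \prod_(e <- enum edge) pe e s.
have tot : \sum_(S : {set edge}) \prod_(e <- enum edge) (if e \in S then pa e s else pb e s) = c.
  rewrite /c -(eq_bigr _ (fun e _ => pab e s)) -wsum_one wsum_sum ?enum_uniq //.
  apply: eq_big => [S|S _]; last by rewrite mulr1.
  by apply/esym/fintype.subsetP => e _; rewrite inE mem_enum.
have good : p * c <= \sum_(S : {set edge} | U S) \prod_(e <- enum edge) (if e \in S then pa e s else pb e s).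
  have : c * bern q (enum edge) (fun S => (U S)%:R) <=
      wsum (pa ^~ s) (pb ^~ s) (enum edge) (fun S => (U S)%:R).
    apply: (@le_wsum_mono _ _ (pa ^~ s) (pb ^~ s) (pe ^~ s) q) => [e|e|e|e||S S' SS|S] //.
    - exact: fine_ge0.
    - exact: fine_ge0.
    rewrite ler_nat; case US: (U S) => //.
    by rewrite (Umono _ _ SS US).
  rewrite (wsum_sum (pa ^~ s) (pb ^~ s) _ (enum_uniq _)) => H.
  have c0 : 0 <= c by apply: prodr_ge0 => e _; exact: fine_ge0.
  rewrite mulrC; apply: le_trans (ler_wpM2l c0 pU) _; apply: le_trans H _.
  rewrite [X in _ <= X]big_mkcond /=.
  rewrite (eq_bigl predT); last first.
    by move=> S; apply/fintype.subsetP => e _; rewrite inE mem_enum.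
  by apply: ler_sum => S _; case: (U S); rewrite ?mulr1 ?mulr0.
have := tot; rewrite (bigID U) /= => E.
rewrite mulrBl mul1r -E; move: good; rewrite -{1}E.
lra.
Qed.

(** The inspections of [s] are followed by [k] inspections at which [U]
    fails. *)
Fixpoint bad_trials (U : {set edge} -> bool) k s : set Om :=
  if k is k'.+1 then \big[setU/set0]_(S : {set edge} | ~~ U S) bad_trials U k' (S :: s)
  else history s.

Lemma bad_trials_measurable U k s : measurable (bad_trials U k s).
Proof.
elim: k s => [|k IHk] s /=; first exact: history_measurable.
by apply: bigsetU_measurable => S _; exact: IHk.
Qed.

Lemma bad_trials_prob (U : {set edge} -> bool) (p : R) k s : p <= 1 ->
  (forall S S', S \subset S' -> U S -> U S') ->
  p <= bern q (enum edge) (fun S => (U S)%:R) ->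
  (P (bad_trials U k s) <= ((1 - p) ^+ k)%:E * P (history s))%E.
Proof.
move=> p1 Umono pU; elim: k s => [|k IHk] s /=; first by rewrite expr0 mul1e.
apply: (@le_trans _ _ (\sum_(S : {set edge} | ~~ U S) P (bad_trials U k (S :: s)))%E).
  by apply: measure_bigsetU_le => S; exact: bad_trials_measurable.
apply: (@le_trans _ _ (\sum_(S : {set edge} | ~~ U S) ((1 - p) ^+ k)%:E * P (history (S :: s)))%E).
  by apply: lee_sum => S _; exact: IHk.
have pk : 0 <= (1 - p) ^+ k by rewrite exprn_ge0 // subr_ge0.
rewrite -ge0_sume_distrr //.
apply: le_trans (lee_wpmul2l _ (history_step s Umono pU)) _; first by rewrite lee_fin.
by rewrite muleA -EFinM -exprSr.
Qed.

End Trials.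

(** * The expected hitting time *)

(** The integral of a nonnegative function is a supremum over the simple
    functions below it, so it is monotone for arbitrary functions.  This is for
    the hitting time, an infimum over uncountably many times. *)
Lemma le_integral_majorant (R : realType) (d : measure_display) (Om : measurableType d)
    (mu : {measure set Om -> \bar R}) (f g : Om -> \bar R) :
  (forall w, 0 <= f w)%E -> (forall w, f w <= g w)%E ->
  (\int[mu]_w f w <= \int[mu]_w g w)%E.
Proof.
move=> f0 fg.
have g0 w : (0 <= g w)%E by exact: le_trans (fg w).
rewrite !ge0_integralTE //; apply: ereal_sup_le => _ [u uf <-].
by exists u => // w; apply: le_trans (uf w) (fg w).
Qed.

Section HittingTime.
Context (R : realType) (alpha : R) (n : nat) (d : measure_display)
  (Om : measurableType d) (P : probability Om R)
  (hold : vpair n -> nat -> {RV P >-> R}).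
Hypotheses (alpha0 : 0 < alpha) (n1 : (1 < n)%N).
Hypothesis dyn : is_dynamic_ER alpha alpha hold.
Variables (T q : R) (N : nat).
Hypotheses (T0 : 0 < T) (N0 : (0 < N)%N) (q01 : 0 <= q <= 1).
Let b := alpha / n.-1%:R.
Hypotheses (qa : q <= expR (- alpha * T))
  (qb : q <= expR (- b * T) * (b / alpha) * expR (- alpha * (T / N%:R)) * (1 - expR (- alpha * T))).
Let edge : finType := {e : {set 'I_n} | #|e| == 2%N}.
Variables (U : {set edge} -> bool) (p thr : R).
Hypotheses (Umono : forall S S' : {set edge}, S \subset S' -> U S -> U S')
  (pU : p <= bern q (enum edge) (fun S => (U S)%:R))
  (p0 : 0 < p)
  (Uhit : forall w t, U (state hold t w) -> has_component_ge (fun e k => hold e k) thr w t).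

Let p1 : p <= 1.
Proof.
apply: le_trans pU _; case/andP: q01 => q0 q1.
rewrite -[X in _ <= X](wsum_const q (enum edge) 1).
by apply: wsum_mono => [_|_|S] //; rewrite ?subr_ge0 // lern1 leq_b1.
Qed.

Lemma mem_bad_trials k s w : history hold T s w ->
  (forall i, (i < k)%N -> ~~ U (state hold ((size s + i).+1%:R * T) w)) ->
  bad_trials hold T U k s w.
Proof.
elim: k s => [//|k IHk] s hw bad /=.
rewrite -bigcup_seq_cond; exists (state hold ((size s).+1%:R * T) w).
  by rewrite /= mem_index_enum /=; have := bad 0%N; rewrite addn0; apply.
apply: IHk => /=.
  move=> e eE; split; first exact: hw.
  rewrite /edge_in inE; case: asboolP => //.
by move=> i ik; have := bad i.+1; rewrite addnS addSn; apply.
Qed.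

Let bad k := bad_trials hold T U k [::].

Let mbad k : measurable (bad k).
Proof. exact: bad_trials_measurable (ltW T0) _ _ _. Qed.

(** The number of failed inspections before the first success, plus one, times
    [T]; if all inspections fail, the series diverges. *)
Lemma hitting_time_le w :
  (hitting_time (fun e k => hold e k) thr w <= \sum_(k <oo) (T * \1_(bad k) w)%:E)%E.
Proof.
have g0 k : (0 <= (T * \1_(bad k) w)%:E)%E by rewrite lee_fin mulr_ge0 // ltW.
have sumbad j : (forall i, (i < j)%N -> ~~ U (state hold (i.+1%:R * T) w)) ->
    ((j.+1%:R * T)%:E <= \sum_(k <oo) (T * \1_(bad k) w)%:E)%E.
  move=> hj.
  apply: (@le_trans _ _ (\sum_(0 <= k < j.+1) (T * \1_(bad k) w)%:E)%E); last first.
    by apply: nneseries_lim_ge.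
  rewrite (eq_big_nat _ _ (F2 := fun=> T%:E)); last first.
    move=> k /andP[_ kj]; rewrite indicE mem_set ?mulr1 //.
    apply: mem_bad_trials => [e _ //|i ik]; rewrite add0n; apply: hj.
    exact: (leq_trans ik).
  by rewrite sumEFin sumr_const_nat subn0 mulr_natl.
have [ex|nex] := pselect (exists i, U (state hold (i.+1%:R * T) w)).
  have [j Uj jmin] := ex_minnP ex.
  apply: (@le_trans _ _ (j.+1%:R * T)%:E).
    apply: ereal_inf_lbound; exists (j.+1%:R * T) => //; split; last exact: Uhit.
    by rewrite mulr_ge0 // ltW.
  apply: sumbad => i ij; apply/negP => /jmin.
  by rewrite leqNgt ij.
suff -> : (\sum_(k <oo) (T * \1_(bad k) w)%:E = +oo)%E by exact: leey.
apply/eqyP => A A0.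
apply: (@le_trans _ _ ((Num.truncn (A / T)).+1%:R * T)%:E).
  rewrite lee_fin -ler_pdivrMr //; apply: ltW.
  by have /andP[] := truncn_itv (divr_ge0 (ltW A0) (ltW T0)).
apply: sumbad => i _; apply/negP => Ui; apply: nex.
by exists i.
Qed.

Lemma expected_hitting_time_le :
  (\int[P]_w hitting_time (fun e k => hold e k) thr w <= (T / p)%:E)%E.
Proof.
apply: (@le_trans _ _ (\int[P]_w (\sum_(k <oo) (T * \1_(bad k) w)%:E))%E).
  apply: le_integral_majorant => w; last exact: hitting_time_le.
  by apply: le_ereal_inf_tmp => _ [t [t0 _] <-]; rewrite lee_fin.
rewrite integral_nneseries //; last 2 first.
- move=> k; apply/measurable_realfun.measurable_EFinP; apply: measurable_realfun.measurable_funM => //.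
- by move=> k w _; rewrite lee_fin mulr_ge0 // ltW.
have bound k : (\int[P]_w (T * \1_(bad k) w)%:E <= (T * (1 - p) ^+ k)%:E)%E.
  under eq_integral do rewrite EFinM.
  rewrite ge0_integralZl_EFin //; last 2 first.
  - exact/measurable_realfun.measurable_EFinP.
  - exact: ltW.
  rewrite integral_indic // setIT EFinM; apply: lee_wpmul2l.
    by rewrite lee_fin ltW.
  apply: le_trans (bad_trials_prob alpha0 n1 dyn (ltW T0) N0 q01 qa qb k [::] p1 Umono pU) _.
  rewrite -[X in (_ <= X)%E]mule1; apply: lee_wpmul2l.
    by rewrite lee_fin exprn_ge0 // subr_ge0.
  by apply: probability_le1; exact: history_measurable (ltW T0) _.
apply: lime_le.
  by apply: is_cvg_nneseries => k _ _; apply: integral_ge0 => w _; rewrite lee_fin mulr_ge0 // ltW.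
apply: nearW => m.
apply: (@le_trans _ _ (\sum_(0 <= k < m) (T * (1 - p) ^+ k)%:E)%E).
  by apply: lee_sum => k _; exact: bound.
rewrite sumEFin lee_fin -mulr_sumr; apply: ler_wpM2l; first exact: ltW.
have geom : p * \sum_(0 <= k < m) (1 - p) ^+ k = 1 - (1 - p) ^+ m.
  rewrite big_mkord; have := subrX1 (1 - p) m; move: (\sum_(i < m) _) => S.
  lra.
rewrite -(ler_pM2l p0) divff ?gt_eqF // geom lerBlDr lerDl.
by rewrite exprn_ge0 // subr_ge0.
Qed.

End HittingTime.

(** * Conclusion *)

Section GiantComponent.
Context (R : realType) (n : nat).
Let edge : finType := {e : {set 'I_n} | #|e| == 2%N}.

Definition large_component (k : nat) (S : {set edge}) : bool :=
  [exists v, (k < #|edge_component (val @: S)%SET v|)%N].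

Lemma large_component_mono k (S S' : {set edge}) :
  S \subset S' -> large_component k S -> large_component k S'.
Proof.
move=> SS /existsP[v kv]; apply/existsP; exists v; apply: leq_trans kv _.
apply: subset_leq_card; apply/fintype.subsetP => u; rewrite !inE.
apply: connect_sub => x y xy; apply: connect1.
exact: (fintype.subsetP (imsetS val SS)).
Qed.

Lemma giant_prob_le (k : nat) (q : R) : (k < n)%N -> 0 <= q <= 1 ->
  giant_prob n k q <=
  bern q (enum edge) (fun S => (large_component k S)%:R).
Proof.
move=> kn q01; have n0 : (0 < n)%N by exact: leq_ltn_trans kn.
pose v := Ordinal n0.
case/andP: (q01) => q0 q1.
apply: (@le_trans _ _ (bern q (enum edge)
    (fun S => (k < #|edge_component (val @: S)%SET v|)%:R))); last first.
  apply: wsum_mono => [_|_|S] //; first by rewrite subr_ge0.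
  rewrite ler_nat; case: leqP => // kS.
  by rewrite (_ : large_component k S) //; apply/existsP; exists v.
rewrite (wsum_map val q (enum edge) (fun S => (k < #|edge_component S v|)%:R)).
have uL : uniq (map val (enum edge)) by rewrite map_inj_uniq ?enum_uniq //; exact: val_inj.
have fL (x y : 'I_n) : x != y -> [set x; y]%SET \in map val (enum edge).
  move=> xy; have c2 : #|[set x; y]%SET| == 2%N by rewrite cards2 xy.
  by apply/mapP; exists (exist _ [set x; y]%SET c2); rewrite ?mem_enum.
have := edge_component_size_ge uL fL q01 v (k := k); rewrite card_ord.
exact.
Qed.

Lemma large_component_hits (k : nat) (thr : R) (Om : Type)
    (hold : vpair n -> nat -> Om -> R) w t :
  thr <= k.+1%:R ->
  large_component k [set e : edge | `[< present hold w t e >]]%SET ->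
  has_component_ge hold thr w t.
Proof.
move=> thrk /existsP[v kv]; exists v; apply: le_trans thrk _.
rewrite ler_nat; apply: leq_trans kv _.
apply: subset_leq_card; apply/fintype.subsetP => u; rewrite !inE.
apply: connect_sub => x y; rewrite /edge_rel => /imsetP[e]; rewrite inE => /asboolP pe xy.
by apply: connect1; apply/asboolP; exists e.
Qed.

End GiantComponent.

(** The second inequality is an equality: with [n] slices,
    [b / alpha = 1 / (n - 1)] and [1 - expR (- alpha * T) = (n - 1) / n]. *)
Lemma step_prob_trials (R : realType) (alpha : R) (n : nat) (T := ln n%:R / alpha)
    (b := alpha / n.-1%:R) : 0 < alpha -> (1 < n)%N ->
  step_prob R n <= expR (- alpha * T) /\
  step_prob R n <= expR (- b * T) * (b / alpha) * expR (- alpha * (T / n%:R))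
     * (1 - expR (- alpha * T)).
Proof.
move=> a0 n1.
have n0 : (0 : R) < n%:R by rewrite ltr0n ltnW.
have m0 : (0 : R) < n.-1%:R by rewrite ltr0n; lia.
have l0 : 0 <= ln n%:R :> R by rewrite ln_ge0 // ler1n ltnW.
have aT : expR (- alpha * T) = n%:R^-1.
  by rewrite /T mulNr mulrCA divff ?gt_eqF // mulr1 expRN lnK ?posrE.
rewrite aT; split.
  rewrite /step_prob ler_pdivrMr // mulVf ?gt_eqF // expR_le1 oppr_le0.
  by rewrite addr_ge0 // divr_ge0 // ltW.
have -> : 1 - n%:R^-1 = n.-1%:R / n%:R :> R.
  have -> : n%:R = n.-1%:R + 1 :> R by rewrite natr1 prednK // ltnW.
  by field; rewrite natr1 gt_eqF // ltr0n.
have -> : expR (- b * T) * (b / alpha) * expR (- alpha * (T / n%:R)) * (n.-1%:R / n%:R) =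
   expR (- b * T) * expR (- alpha * (T / n%:R)) / n%:R.
  rewrite /b; move: (expR _) (expR _) => u v; field.
  by rewrite !gt_eqF.
rewrite -expRD /step_prob le_eqVlt; apply/orP; left; apply/eqP.
congr (expR _ / _); rewrite /b /T; field.
by rewrite !gt_eqF.
Qed.

(** Only an upper bound on the exponent enters the theorem, hence the maximum
    with zero. *)
Lemma cvg_giant_rate_excess (R : realType) :
  Num.max 0 (giant_rate eps - eps ^+ 3 / 8) / eps ^+ 3 @[eps --> (0 : R)^'+] --> (0 : R).
Proof.
have up : (eps / 2 : R) @[eps --> (0 : R)^'+] --> (0 : R).
  rewrite -[X in _ --> X](mul0r (2^-1)); apply: cvgM; last exact: cvg_cst.
  by apply: cvg_at_right_filter; exact: cvg_id.
apply: (squeeze_cvgr _ (cvg_cst (0 : R)) up); near=> e.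
have e0 : 0 < e by near: e; exact: nbhs_right_gt.
have e1 : e <= 2^-1 by near: e; apply: nbhs_right_le.
have e3 : 0 < e ^+ 3 by exact: exprn_gt0.
rewrite divr_ge0 ?le_max ?lexx ?(ltW e3) //= ler_pdivrMr // ge_max.
have -> : e / 2 * e ^+ 3 = e ^+ 4 / 2 by field.
rewrite divr_ge0 ?exprn_ge0 ?(ltW e0) //=.
by have := @giant_rate_le _ e; rewrite e0 e1 => /(_ isT); lra.
Unshelve. all: by end_near.
Qed.

Theorem mainTheorem5 (R : realType) (alpha : R) (alpha_gt0 : 0 < alpha) :
  exists r : R -> R,
    (r eps / eps ^+ 3 @[eps --> 0^'+] --> 0) /\
    forall eps : R, 0 < eps < 1 ->
    exists h : nat -> R,
      (h n / n%:R @[n --> \oo] --> 0) /\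
      exists N : nat, forall n : nat, (2 <= n)%N -> (N <= n)%N ->
      forall (d : measure_display) (Om : measurableType d)
        (P : probability Om R) (hold : vpair n -> nat -> {RV P >-> R}),
        is_dynamic_ER alpha alpha hold ->
        (\int[P]_w hitting_time (fun e k => hold e k) (eps * n%:R) w
         <= (expR (n%:R * (eps ^+ 3 / 8 + r eps) + h n))%:E)%E.
Proof.
exists (fun eps => Num.max 0 (giant_rate eps - eps ^+ 3 / 8)); split.
  exact: cvg_giant_rate_excess.
move=> eps eps01; have [h [h0 [N HN]]] := giant_prob_rate alpha_gt0 eps01.
exists h; split => //; exists N => n n2 /HN [kn rate_bound] d Om P hold dyn.
set k := Num.truncn _ in kn rate_bound; set q := step_prob R n in rate_bound.
pose T := ln n%:R / alpha.
have T0 : 0 < T by rewrite divr_gt0 // ln_gt0 // ltr1n.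
have q01 : 0 < q < 1 by exact: step_prob_itv.
have q01' : 0 <= q <= 1 by case/andP: q01 => *; rewrite !ltW.
have [qa qb] := step_prob_trials alpha_gt0 n2.
have thr : eps * n%:R <= k.+1%:R.
  have en : 0 <= eps * n%:R by case/andP: eps01 => e0 _; rewrite mulr_ge0 // ltW.
  by have /andP[_ /ltW] := truncn_itv en.
have := expected_hitting_time_le alpha_gt0 n2 dyn T0 (ltnW n2) q01' qa qb
  (large_component_mono (k := k)) (giant_prob_le kn q01') (giant_prob_gt0 kn q01)
  (fun w t => large_component_hits (w := w) (t := t) thr).
move=> /le_trans; apply; rewrite lee_fin; apply: le_trans rate_bound _.
rewrite ler_expR lerD2r; apply: ler_wpM2l => //.
by rewrite -lerBlDl le_max lexx orbT.
Qed.
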